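(* Let $G$ be a locally finite Borel graph on a standard Borel space $X$ such that no connected component of $G$ is a Gallai tree. Then $G$ is Borel degree-list-colorable.
   Context: A graph on a set $X$ is a symmetric irreflexive relation $G$ on $X$; it is locally finite if every vertex $x$ has finite degree $\deg_G(x)$ (number of neighbors). A Borel graph on a standard Borel space $X$ is a graph on $X$ that is Borel as a subset of $X \times X$. A set $S$ of vertices of a graph $G$ is biconnected if the induced subgraph $G \restriction S$ is connected and remains connected after removing any single vertex from $S$. A block of $G$ is a maximal biconnected set. A Gallai tree is a connected graph (finite or infinite) each of whose blocks induces a complete graph or an odd cycle. For a standard Borel space $Y$, $[Y]^{<\infty}$ denotes the standard Borel space of finite subsets of $Y$, with the Borel structure induced as a quotient of $\bigsqcup_{n \in \mathbb{N}} Y^n$. A coloring of $G$ from lists $L$ is a function $c$ on $X$ with $c(x) \in L(x)$ for all $x$ and $c(x) \neq c(y)$ whenever $x \mathrel{G} y$. A locally finite Borel graph $G$ on $X$ is Borel degree-list-colorable if for every Polish space $Y$ and every Borel function $L \colon X \to [Y]^{<\infty}$ with $|L(x)| = \deg_G(x)$ for all $x \in X$, there is a Borel function $c \colon X \to Y$ that is a coloring of $G$ from the lists $L$. *)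

(* Defs.v *)
From Stdlib Require Import Relation_Operators.
From mathcomp Require Import all_boot all_order all_algebra finmap.
From mathcomp Require Import all_classical all_reals.
From mathcomp Require Import topology metric_structure measure.

Set Implicit Arguments.
Unset Strict Implicit.
Unset Printing Implicit Defensive.

Local Open Scope classical_set_scope.

(* The library's measurable types and complete uniform
   types are pointed, which would exclude the empty space; sigma-algebras are
   therefore explicit sets of sets, built with the library's [sigma_algebra] and
   [<<s _ >>], and completeness is the unpointed form of [cauchy_cvg]. *)

Definition separable (T : topologicalType) : Prop :=
  exists2 D : set T, countable D & dense D.

Definition complete_uniform (T : uniformType) : Prop :=
  forall F : set_system T, ProperFilter F -> cauchy F -> exists x : T, F --> x.

(* [R] is any model of the real numbers, where the metric takes its values. *)
Definition completely_metrizable (R : realType) (T : topologicalType) : Prop :=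
  exists (M : metricType R) (f : T -> M) (g : M -> T),
    [/\ cancel f g, cancel g f, continuous f, continuous g
      & complete_uniform M].

Definition polish (R : realType) (T : topologicalType) : Prop :=
  separable T /\ completely_metrizable R T.

Definition borel (T : topologicalType) : set (set T) := <<s @open T >>.
Arguments borel T : clear implicits.

Definition standard_borel (R : realType) (X : Type) (SX : set (set X)) : Prop :=
  exists (T : topologicalType) (f : X -> T),
    [/\ polish R T, bijective f & SX = [set f @^-1` B | B in borel T]].

Definition borel_fun (X Y : Type) (SX : set (set X)) (SY : set (set Y))
    (f : X -> Y) : Prop :=
  forall B, SY B -> SX (f @^-1` B).

Definition prod_algebra (X Y : Type) (SX : set (set X)) (SY : set (set Y)) :
    set (set (X * Y)) :=
  <<s [set A `*` B | A in SX & B in SY] >>.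

Definition tuple_algebra (n : nat) (Y : Type) (SY : set (set Y)) :
    set (set (n.-tuple Y)) :=
  <<s \bigcup_(i in [set: 'I_n])
        preimage_set_system [set: n.-tuple Y] (fun t => tnth t i) SY >>.

(* The quotient of the disjoint union of the Y^n by the map sending a tuple to
   the finite set of its entries. *)
Definition fset_algebra (Y : choiceType) (SY : set (set Y)) :
    set (set {fset Y}) :=
  [set A | forall n : nat,
     tuple_algebra SY [set t : n.-tuple Y | A [fset y in tval t]%fset]].

Section graphs.
Variable X : choiceType.
Implicit Types (G : X -> X -> Prop) (S B C : set X) (x y : X).

Definition is_graph G : Prop :=
  (forall x y, G x y -> G y x) /\ (forall x, ~ G x x).

Definition borel_graph (SX : set (set X)) G : Prop :=
  is_graph G /\ prod_algebra SX SX [set p : X * X | G p.1 p.2].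

Definition neighbors G x : set X := [set y | G x y].

Definition locally_finite G : Prop := forall x, finite_set (neighbors G x).

(* Meaningful only when [neighbors G x] is finite. *)
Definition degree G x : nat := #|` fset_set (neighbors G x)|.

Definition induced G S : X -> X -> Prop := fun x y => [/\ S x, S y & G x y].

(* The empty set counts as connected; with the opposite convention the notion
   of Gallai tree below would be the same on nonempty sets. *)
Definition connected_on G S : Prop :=
  forall x y, S x -> S y -> clos_refl_trans X (induced G S) x y.

Definition biconnected G S : Prop :=
  connected_on G S /\ forall x, S x -> connected_on G (S `\ x).

(* Blocks of the induced subgraph [G|C]. *)
Definition block G C B : Prop :=
  [/\ B `<=` C, biconnected G B
    & forall B', B' `<=` C -> biconnected G B' -> B `<=` B' -> B' = B].

Definition complete_on G S : Prop :=
  forall x y, S x -> S y -> x <> y -> G x y.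

Definition odd_cycle_on G S : Prop :=
  exists s : seq X,
    [/\ uniq s, odd (size s) & (2 < size s)%N] /\ S = [set` s] /\
    forall x y, x \in s -> y \in s -> G x y <-> y = next s x \/ x = next s y.

Definition gallai_tree_on G C : Prop :=
  connected_on G C /\
  forall B, block G C B -> complete_on G B \/ odd_cycle_on G B.

Definition component G x : set X := [set y | clos_refl_trans X G x y].

Definition list_coloring (Y : choiceType) G (L : X -> {fset Y}) (c : X -> Y) :
    Prop :=
  (forall x, c x \in L x) /\ (forall x y, G x y -> c x <> c y).

Definition borel_degree_list_colorable (R : realType) (SX : set (set X)) G :
    Prop :=
  forall Y : topologicalType, polish R Y ->
  forall L : X -> {fset Y},
    borel_fun SX (fset_algebra (borel Y)) L ->
    (forall x, #|` L x| = degree G x) ->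
  exists c : X -> Y, borel_fun SX (borel Y) c /\ list_coloring G L c.

End graphs.

(* Main.v *)
(* Let the lists be given, so that deg is Borel because |L| = deg.  Then G has
   Borel neighbourhoods: G x meets a Borel set B in an analytic set of x, and
   misses B exactly when deg x many neighbours lie outside B, which is also
   analytic, so Lusin separation applies.  Hence neighbours and lists have Borel
   enumerations, and quantification over a component is countable.

   A finite connected graph with lists of size at least the degrees is colourable
   as soon as one list is larger than the degree.  So if a biconnected finite
   graph is not colourable, all its lists are equal and it is regular.  A
   biconnected set that is neither complete nor an odd cycle contains a finite
   set inducing an even cycle or an irregular biconnected graph, and these are
   degree-choosable.

   Choose in a Borel way a family of finite degree-choosable sets, pairwise
   disjoint and nonadjacent, that meets every component, and let A be its union.
   Outside A colour greedily: first, by rank, the points from which the distance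
   to A cannot increase along an infinite path, then the others by increasing
   distance.  Each point still has an uncoloured neighbour when its turn comes.
   The pieces of A are coloured last, each independently of the others. *)

Require Import Defs.
From Stdlib Require Import Relation_Operators Operators_Properties.
From mathcomp Require Import all_boot all_order all_algebra finmap.
From mathcomp Require Import zify lra.
From mathcomp Require Import all_classical all_reals.
From mathcomp Require Import topology metric_structure measure.

Set Implicit Arguments.
Unset Strict Implicit.
Unset Printing Implicit Defensive.

Local Open Scope classical_set_scope.

(** * Degree-choosable finite subgraphs *)

(** The obstacle is definability: every choice is made as the least element of a countable set whose
    members are tested by Borel conditions. Finite subsets of a component are therefore coded by
    shapes, which are lists of words in Borel maps enumerating closed neighbourhoods, and colours by
    indices into Borel enumerations of the lists. Choosability from all lists at once lets the
    pieces be fixed before any colour is known: for a given shape it depends on finitely many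
    adjacency bits. It survives the colouring of the outside because each outside neighbour removes
    at most one colour together with one unit of degree. Colouring the far points first would be
    natural, but it is not well founded where the distance to [A] can grow forever. There each point
    has a farther neighbour of the same kind, so the opposite order works; elsewhere local
    finiteness makes the ranks finite. No single piece can be selected from an infinite component in
    a Borel way; all minimisers of a countably valued invariant are kept instead. *)

Lemma rt_sub (T : Type) (r r' : T -> T -> Prop) :
  (forall x y, r x y -> r' x y) ->
  forall x y, clos_refl_trans T r x y -> clos_refl_trans T r' x y.
Proof.
move=> sub x y; elim=> [a b /sub|a|a b c _ ab _ bc]; first exact: rt_step.
  exact: rt_refl.
exact: rt_trans ab bc.
Qed.

Section degree_choosable.
Variables (X Y : choiceType) (y0 : Y) (G : X -> X -> Prop).
Hypothesis graphG : is_graph G.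
Implicit Types (S : {fset X}) (M : X -> {fset Y}) (v : X -> Y).

Let Gsym x y : G x y -> G y x. Proof. exact: graphG.1. Qed.

Definition nbrs_in S x : {fset X} := [fset y in S | `[<G x y>]]%fset.

Lemma in_nbrs_in S x y : (y \in nbrs_in S x) = (y \in S) && `[<G x y>].
Proof. by rewrite !inE. Qed.

Definition coloring_on S M v : Prop :=
  {in S, forall x, v x \in M x} /\ {in S &, forall x y, G x y -> v x <> v y}.

(** Nonemptiness is included because a piece must contribute a point to its component. Lists may
    exceed the degree, as those left after colouring the outside can. *)
Definition degree_choosable S : Prop := (exists x, x \in S) /\
  forall M, {in S, forall x, #|` nbrs_in S x| <= #|` M x|} ->
    exists v, coloring_on S M v.

Definition slack S M x : Prop := (#|` nbrs_in S x| < #|` M x|)%N.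


Lemma nbrs_in_sub S S' x : (S' `<=` S)%fset ->
  (nbrs_in S' x `<=` nbrs_in S x)%fset.
Proof.
move=> SS'; apply/fsubsetP => y; rewrite !in_nbrs_in => /andP[yS' ->].
by rewrite (fsubsetP SS').
Qed.

Lemma card_nbrs_in_rem S x u : u \in S -> G x u ->
  (#|` nbrs_in (S `\ u)%fset x| < #|` nbrs_in S x|)%N.
Proof.
move=> uS xu; rewrite (cardfsD1 u (nbrs_in S x)) in_nbrs_in uS asboolT//=.
rewrite add1n ltnS; apply: fsubset_leq_card; apply/fsubsetP => y.
by rewrite in_fsetD1 !in_nbrs_in !inE -andbA.
Qed.

Lemma card_nbrs_in_le S x u :
  (#|` nbrs_in (S `\ u)%fset x| <= #|` nbrs_in S x|)%N.
Proof. by apply/fsubset_leq_card/nbrs_in_sub; rewrite fsubD1set. Qed.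

Lemma exists_avoiding (D : {fset X}) (A : {fset Y}) v : (#|` D| < #|` A|)%N ->
  exists2 a, a \in A & {in D, forall y, v y <> a}.
Proof.
move=> DA; suff : exists a, a \in (A `\` [fset v y | y in D])%fset.
  case=> a; rewrite inE => /andP[na aA]; exists a => // y yD va.
  by case/negP: na; apply/imfsetP; exists y.
apply/fset0Pn; rewrite fsetD_eq0; apply/negP => /fsubset_leq_card.
by rewrite leqNgt (leq_ltn_trans (leq_imfset_card _ _ _)).
Qed.

(* A vertex with slack is removed and coloured last; its neighbours then have
   slack, so the path condition survives. *)
Lemma slack_colorable S M :
  {in S, forall x, #|` nbrs_in S x| <= #|` M x|} ->
  {in S, forall x, exists y,
    [/\ y \in S, clos_refl_trans X (induced G [set` S]) x y & slack S M y]} ->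
  exists v, coloring_on S M v.
Proof.
have [n] := ubnP #|` S|; elim: n S => // n IHn S; rewrite ltnS => Sn MS Sslack.
have [S0|[x0 x0S]] := fset_0Vmem S.
  by exists (fun=> y0); split=> x; rewrite S0 inE.
have [u [uS _ us]] := Sslack _ x0S.
set S' := (S `\ u)%fset.
have S'S x : x \in S' -> x \in S by rewrite inE => /andP[].
have slack_nbr x : x \in S -> G x u -> slack S' M x.
  by move=> xS /(card_nbrs_in_rem uS) /leq_trans; apply; apply: MS.
have [||| v [vM vp]] := IHn S'.
- by move: Sn; rewrite (cardfsD1 u S) uS.
- by move=> x xS'; rewrite (leq_trans (card_nbrs_in_le _ _ _)) ?MS ?S'S.
- move=> x xS'; have [z [zS /clos_rt_rt1n_iff xz zs]] := Sslack x (S'S _ xS').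
  elim: xz xS' zs {zS} => [{}z zS' zs|{}x y {}z [xS yS xy] _ IH xS' zs].
    exists z; split => //; first exact: rt_refl.
    by apply: leq_ltn_trans zs; apply: card_nbrs_in_le.
  have [yu|yu] := eqVneq y u.
    exists x; split=> //; first exact: rt_refl.
    by apply: slack_nbr => //; rewrite -yu.
  have yS' : y \in S' by rewrite !inE yu.
  have [w [wS' yw ws]] := IH yS' zs; exists w; split => //.
  by apply: rt_trans yw; apply: rt_step.
have [a aM av] := exists_avoiding v us.
have av' x : x \in S -> G u x -> v x <> a.
  by move=> xS ux; apply: av; rewrite in_nbrs_in xS; apply/asboolP.
exists (fun x => if x == u then a else v x); split=> [x xS|x y xS yS xy].
  by case: eqVneq => [->//|xu]; apply: vM; rewrite !inE xu.
case: eqVneq => [xu|xu]; case: eqVneq => [yu|yu].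
- by case: (graphG.2 u); rewrite -{1}xu -yu.
- by apply/nesym/av' => //; rewrite -xu.
- by apply: av' => //; apply: Gsym; rewrite -yu.
- by apply: vp => //; rewrite !inE ?xu ?yu.
Qed.

(* If a neighbour x of u lacked the colour a of u, then giving a to u would
   leave x with slack. *)
Lemma biconnected_uncolorable S M : biconnected G [set` S] ->
  {in S, forall x, #|` nbrs_in S x| <= #|` M x|} ->
  ~ (exists v, coloring_on S M v) ->
  {in S &, forall x y, M x = M y} /\
  {in S, forall x, #|` M x| = #|` nbrs_in S x|}.
Proof.
move=> [Sconn Sbi] MS nocol.
have noslack : {in S, forall x, ~ slack S M x}.
  move=> x xS xs; apply: nocol; apply: slack_colorable => // y yS.
  by exists x; split => //; apply: Sconn.
have cardM : {in S, forall x, #|` M x| = #|` nbrs_in S x|}.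
  by move=> x xS; apply/eqP; rewrite eqn_leq MS// leqNgt andbT; apply/negP/noslack.
have Msub u x : u \in S -> x \in S -> G u x -> (M u `<=` M x)%fset.
  move=> uS xS ux; apply/fsubsetP => a aM; apply: contrapT => /negP axM.
  apply: nocol; set S' := (S `\ u)%fset.
  pose M' y := if `[<G u y>] then (M y `\ a)%fset else M y.
  have S'S y : y \in S' -> y \in S by rewrite inE => /andP[].
  have xS' : x \in S'.
    rewrite !inE xS andbT; apply/eqP => xu; apply: (graphG.2 u).
    by rewrite -{2}xu.
  have [||v [vM vp]] := @slack_colorable S' M'.
  - move=> y yS'; rewrite /M'; case: asboolP => uy.
      have := card_nbrs_in_rem uS (Gsym uy); rewrite -(cardM _ (S'S _ yS')).
      by rewrite (cardfsD1 a (M y)); case: (a \in M y); rewrite ?ltnS// => /ltnW.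
    by rewrite (leq_trans (card_nbrs_in_le _ _ _)) ?MS ?S'S.
  - move=> y yS'; exists x; split => //.
      have := Sbi u uS y x.
      rewrite (_ : [set` S] `\ u = [set` S']); first by apply.
      apply/seteqP; split=> z /=; rewrite !inE.
        by move=> [-> /eqP ->].
      by move=> /andP[/eqP ? ->].
    rewrite /slack /M' asboolT// mem_fsetD1//.
    by rewrite (leq_trans (card_nbrs_in_rem uS (Gsym ux))) ?MS.
  have v'M y : y \in S' -> v y \in M y.
    by move=> /vM; rewrite /M'; case: asboolP => // _; rewrite inE => /andP[].
  have v'a y : y \in S' -> G u y -> v y <> a.
    by move=> /vM; rewrite /M' => + uy; rewrite asboolT// !inE => /andP[/eqP].
  exists (fun x => if x == u then a else v x); split=> [y yS|y z yS zS yz].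
    by case: eqVneq => [->//|yu]; apply: v'M; rewrite !inE yu.
  case: eqVneq => [yu|yu]; case: eqVneq => [zu|zu].
  - by case: (graphG.2 u); rewrite -{1}yu -zu.
  - by apply/nesym/v'a; rewrite ?inE ?zu// -yu.
  - by apply: v'a; rewrite ?inE ?yu//; apply: Gsym; rewrite -zu.
  - by apply: vp => //; rewrite !inE ?yu ?zu.
split=> // x y xS yS; have := Sconn x y xS yS.
elim=> [a b [aS bS ab]|//|a b c _ -> _ ->//].
by apply/eqP; rewrite eqEfsubset !Msub//; apply: Gsym.
Qed.

Lemma irregular_choosable S x y : biconnected G [set` S] ->
  x \in S -> y \in S -> #|` nbrs_in S x| <> #|` nbrs_in S y| ->
  degree_choosable S.
Proof.
move=> biS xS yS xy; split=> [|M MS]; first by exists x.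
apply: contrapT => nocol; apply: xy.
have [eqM cM] := biconnected_uncolorable biS MS nocol.
by rewrite -!cM// (eqM x y).
Qed.

(** If no colouring existed, all lists would be one list with at least two colours, and giving one
    of these to each side would be a colouring. *)
Lemma bipartite_choosable S (c : X -> bool) : biconnected G [set` S] ->
  {in S &, forall x y, G x y -> c x <> c y} ->
  {in S, forall x, 2 <= #|` nbrs_in S x|} ->
  (exists x, x \in S) -> degree_choosable S.
Proof.
move=> biS cS S2 [x0 x0S]; split=> [|M MS]; first by exists x0.
apply: contrapT => nocol; have := nocol; apply.
have [eqM cM] := biconnected_uncolorable biS MS nocol.
have M2 : 2 <= #|` M x0| by rewrite cM ?S2.
have [a aM] : exists a, a \in M x0.
  by apply/fset0Pn; rewrite -cardfs_gt0; case: #|` _| M2.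
have [b] : exists b, b \in (M x0 `\ a)%fset.
  by apply/fset0Pn; rewrite -cardfs_gt0; move: M2; rewrite (cardfsD1 a) aM.
rewrite !inE => /andP[/eqP ba bM].
exists (fun x => if c x then a else b); split=> [x xS|x y xS yS xy].
  by rewrite (eqM x x0)//; case: ifP.
by have := cS x y xS yS xy; case: (c x); case: (c y) => // _; apply/nesym.
Qed.

End degree_choosable.

(** * Paths, cycles and biconnected sets *)

Section connectivity.
Variables (X : choiceType) (G : X -> X -> Prop).
Hypothesis graphG : is_graph G.
Implicit Types (A B D T : set X) (x y : X) (s p : seq X).

Let Gsym x y : G x y -> G y x. Proof. exact: graphG.1. Qed.

Let e : rel X := fun x y => `[<G x y>].

Lemma reach_sym A x y : clos_refl_trans X (induced G A) x y ->
  clos_refl_trans X (induced G A) y x.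
Proof.
elim=> [a b [aA bA ab]|a|a b c _ ab _ bc].
- by apply: rt_step; split => //; apply: Gsym.
- exact: rt_refl.
- exact: rt_trans bc ab.
Qed.

Lemma reach_sub A B x y : A `<=` B -> clos_refl_trans X (induced G A) x y ->
  clos_refl_trans X (induced G B) x y.
Proof.
by move=> AB; apply: rt_sub => a b [aA bA ab]; split => //; apply: AB.
Qed.

Lemma connected_union A B a b : connected_on G A -> connected_on G B ->
  A a -> B b -> a = b \/ G a b -> connected_on G (A `|` B).
Proof.
move=> cA cB Aa Bb ab.
have inA x y : A x -> A y -> clos_refl_trans X (induced G (A `|` B)) x y.
  by move=> Ax Ay; apply: (@reach_sub A); [left|exact: cA].
have inB x y : B x -> B y -> clos_refl_trans X (induced G (A `|` B)) x y.
  by move=> Ax Ay; apply: (@reach_sub B); [right|exact: cB].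
have ab' : clos_refl_trans X (induced G (A `|` B)) a b.
  case: ab => [->|ab]; first exact: rt_refl.
  by apply: rt_step; split => //; [left|right].
have AB x y : A x -> B y -> clos_refl_trans X (induced G (A `|` B)) x y.
  move=> Ax By; apply: rt_trans (inA x a Ax Aa) _.
  exact: rt_trans ab' (inB b y Bb By).
move=> x y [xA|xB] [yA|yB].
- exact: inA.
- exact: AB.
- by apply: reach_sym; apply: AB.
- exact: inB.
Qed.

Lemma path_connected x p : path e x p -> connected_on G [set` x :: p].
Proof.
elim: p x => [|y p IHp] x /=.
  move=> _ a b /=; rewrite !inE => /eqP -> /eqP ->; exact: rt_refl.
move=> /andP[/asboolP xy /IHp cp].
have cx : connected_on G [set x] by move=> a b /= -> ->; exact: rt_refl.
rewrite (_ : [set` [:: x, y & p]] = [set x] `|` [set` y :: p]).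
  apply: (connected_union (a := x) (b := y)) => //=; last by right.
  by rewrite inE eqxx.
apply/seteqP; split=> z /=; rewrite [z \in x :: _]inE.
  by move=> /orP[/eqP|]; [left|right].
by move=> [->|->]; rewrite ?eqxx ?orbT.
Qed.

Lemma cycle_biconnected s : uniq s -> cycle e s -> biconnected G [set` s].
Proof.
move=> us cs; split.
  case: s us cs => [|x p] _; first by move=> _ a b.
  by rewrite /cycle rcons_path => /andP[/path_connected].
(* With the removed vertex rotated to the front, the rest of the cycle is a path. *)
move=> x xs; have [i s' def_s] := rot_to xs.
have us' : uniq (x :: s') by rewrite -def_s rot_uniq.
have cs' : cycle e (x :: s') by rewrite -def_s rot_cycle.
have -> : [set` s] `\ x = [set` s'].
  move: us' => /= /andP[xs' _].
  apply/seteqP; split=> z /=; rewrite -(mem_rot i s) def_s inE.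
    by move=> [/orP[/eqP|]].
  by move=> zs'; rewrite zs' orbT; split=> // zx; rewrite -zx zs' in xs'.
case: s' {def_s us'} cs' => [|y p] /=; first by move=> _ a b.
by rewrite rcons_path => /andP[_ /andP[/path_connected]].
Qed.

(** Of two common vertices, one survives any removal and still joins the two sets. *)
Lemma biconnected_union A B x y : biconnected G A -> biconnected G B ->
  A x -> B x -> A y -> B y -> x <> y -> biconnected G (A `|` B).
Proof.
move=> [cA bA] [cB bB] Ax Bx Ay By xy; split.
  by apply: (connected_union (a := x) (b := x)) => //; left.
have rem D u : connected_on G D -> (forall x, D x -> connected_on G (D `\ x)) ->
    connected_on G (D `\ u).
  by move=> cD bD; have [/bD//|Du] := pselect (D u); rewrite not_setD1.
move=> u _; rewrite setDUl.
have [z [Az Bz zu]] : exists z, [/\ A z, B z & z <> u].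
  have [xu|] := pselect (x = u); last by exists x.
  by exists y; rewrite -xu; split=> //; apply/nesym.
apply: (connected_union (a := z) (b := z)) => //; [exact: rem|exact: rem|].
by left.
Qed.

Lemma nth_last_take x p i : i <= size p ->
  last x (take i p) = nth x (x :: p) i.
Proof.
move=> ip; rewrite (last_nth x) size_takel//.
by rewrite -[x :: take i p]/(take i.+1 (x :: p)) nth_take.
Qed.

(** The three properties reflect three ways to shorten a path: removing loops, stopping at the first
    vertex in [T], and taking a chord. *)
Lemma shortest_path D T x y :
  D x -> T y -> clos_refl_trans X (induced G D) x y ->
  exists p, [/\ path e x p /\ {in x :: p, forall z, D z}, uniq (x :: p),
    T (last x p), (forall i, i < size p -> ~ T (nth x (x :: p) i)) &
    forall i j, i < j -> j <= size p ->
      G (nth x (x :: p) i) (nth x (x :: p) j) -> j = i.+1].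
Proof.
move=> Dx Ty xy.
pose good n := `[<exists p, [/\ path e x p, {in x :: p, forall z, D z},
  T (last x p) & size p = n]>].
have [|n /asboolP[p [pp pD pT <-]] min] := @ex_minnP good.
  suff [p [pp pD pT]] : exists p,
    [/\ path e x p, {in x :: p, forall z, D z} & T (last x p)].
    by exists (size p); apply/asboolP; exists p.
  move: xy => /clos_rt_rt1n_iff xy.
  elim: xy Dx Ty => [z Dz Tz|a b c [Da Db ab] _ IH _ Tc].
    by exists [::]; split=> // u; rewrite inE => /eqP ->.
  have [p [pp pD pT]] := IH Db Tc.
  exists (b :: p); split => //=; first by rewrite pp andbT; apply/asboolP.
  by move=> u; rewrite inE => /predU1P[->//|/pD].
(* Competitors use only vertices of [p], so they automatically stay in [D]. *)
have minp q : path e x q -> {subset q <= p} -> T (last x q) -> size p <= size q.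
  move=> qp qsub qT; apply: min; apply/asboolP; exists q; split=> // z.
  rewrite inE => /predU1P[->//|/qsub zp]; apply: pD.
  by rewrite inE zp orbT.
exists p; split => //.
- case/shortenP: (pp) pT => q qp uq qsub qT.
  apply: leq_size_uniq uq _ _; last by rewrite /= ltnS minp.
  by move=> z; rewrite !inE => /predU1P[->|/qsub ->]; rewrite ?eqxx ?orbT.
- move=> i ip; have iple := ltnW ip; rewrite -(nth_last_take x iple) => Ti.
  have : size p <= size (take i p).
    by apply: minp => //; [exact: take_path|move=> z; exact: mem_take].
  by rewrite size_takel// leqNgt ip.
- move=> i j ij jp Gij; apply/eqP; rewrite eqn_leq ij andbT leqNgt; apply/negP => ij1.
  have ip : i < size p by lia.
  have jE : drop j.-1 p = nth x (x :: p) j :: drop j p.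
    by case: j ij jp {Gij ij1} => //= j _ jp; rewrite (drop_nth x jp).
  have iE : last x (take i p) = nth x (x :: p) i.
    exact/nth_last_take/ltnW.
  (* Go to position [i], then along the chord to position [j]; the index is [j.-1] because [p] omits
     the start [x]. *)
  have : size p <= size (take i p ++ drop j.-1 p).
    apply: minp.
    - rewrite cat_path take_path//= jE /= iE; apply/andP; split.
        by apply/asboolP.
      have := pp; rewrite -{1}(cat_take_drop j p) cat_path => /andP[_].
      by rewrite nth_last_take.
    - by move=> z; rewrite mem_cat => /orP[/mem_take|/mem_drop].
    - have : last x p = last x (take i p ++ drop j.-1 p).
        rewrite last_cat -{1}(cat_take_drop j.-1 p) last_cat jE //.
      by move=> <-.
  rewrite size_cat size_take size_drop ip; lia.
Qed.

End connectivity.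

Lemma next_nth_uniq (T : eqType) (x0 : T) (s : seq T) i : uniq s -> i < size s ->
  next s (nth x0 s i) = nth x0 s (if i.+1 < size s then i.+1 else 0).
Proof.
case: s => // y s us; rewrite next_nth => iS; rewrite mem_nth// index_uniq//.
rewrite [size (y :: s)]/= ltnS in iS *; case: ltnP => is_ /=; last by rewrite nth_default.
exact: set_nth_default.
Qed.

Lemma next_neq (T : eqType) (s : seq T) x : uniq s -> 2 < size s -> x \in s ->
  next s x <> x /\ next s (next s x) <> x.
Proof.
move=> us s2 /(nthP x)[i iS <-]; rewrite next_nth_uniq//.
have iS' : (if i.+1 < size s then i.+1 else 0) < size s by case: ifP; lia.
rewrite next_nth_uniq//; split=> /eqP; rewrite nth_uniq//.
- by case: ifP; lia.
- by case: (ltnP i.+1 (size s)) => ?; case: ifP; lia.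
- by case: (ltnP i.+1 (size s)) => ?; case: ifP; lia.
Qed.

(** Parity of position is a proper 2-colouring of an even cycle: the closing edge runs from an odd
    last index to 0. *)
Lemma odd_index_next (T : eqType) (s : seq T) x :
  uniq s -> ~~ odd (size s) -> x \in s ->
  odd (index (next s x) s) = ~~ odd (index x s).
Proof.
move=> us sev /(nthP x)[i iS <-]; rewrite next_nth_uniq//.
have iS' : (if i.+1 < size s then i.+1 else 0) < size s by case: ifP; lia.
rewrite !index_uniq//; case: ifP => //= iN.
have iE : size s = i.+1 by lia.
by move: sev; rewrite iE /=; case: odd.
Qed.

Lemma mem_fset_seq (T : choiceType) (s : seq T) x :
  (x \in [fset y in s]%fset) = (x \in s).
Proof. by rewrite !inE. Qed.

Lemma leq_size_fset (T : choiceType) (A : {fset T}) (t : seq T) :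
  uniq t -> {subset t <= A} -> size t <= #|` A|.
Proof. by move=> ut tA; apply: uniq_leq_size ut tA. Qed.

Lemma fset_leq_size (T : choiceType) (A : {fset T}) (t : seq T) :
  {subset A <= t} -> #|` A| <= size t.
Proof. by move=> At; apply: uniq_leq_size (fset_uniq A) At. Qed.

Lemma rt_crossing (T : Type) (r : T -> T -> Prop) (P : T -> Prop) x y :
  clos_refl_trans T r x y -> P x -> ~ P y -> exists a b, [/\ r a b, P a & ~ P b].
Proof.
move=> /clos_rt_rt1n_iff; elim=> [//|a b c ab _ IH Pa Pc].
by have [Pb|Pb] := pselect (P b); [exact: IH|exists a, b].
Qed.

(** * Choosable subsets of biconnected sets *)

Section gallai.
Variables (X Y : choiceType) (y0 : Y) (G : X -> X -> Prop).
Hypothesis graphG : is_graph G.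
Implicit Types (B : set X) (x y : X) (s p : seq X) (S : {fset X}).

Let Gsym x y : G x y -> G y x. Proof. exact: graphG.1. Qed.
Let Girr x : ~ G x x. Proof. exact: graphG.2. Qed.

Let e : rel X := fun x y => `[<G x y>].

Definition induced_cycle s : Prop := uniq s /\
  forall x y, x \in s -> y \in s -> G x y <-> y = next s x \/ x = next s y.

Lemma induced_cycleI x0 s : uniq s -> 2 < size s ->
  (forall i j, i < j -> j < size s ->
     G (nth x0 s i) (nth x0 s j) <-> j = i.+1 \/ i = 0 /\ j.+1 = size s) ->
  induced_cycle s.
Proof.
move=> us s2 H; split=> // x y /(nthP x0)[i iS <-] /(nthP x0)[j jS <-].
have nE k l : k < size s -> l < size s ->
    nth x0 s k = next s (nth x0 s l) <-> k = if l.+1 < size s then l.+1 else 0.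
  move=> kS lS; rewrite next_nth_uniq//; split=> [/eqP|->//].
  by rewrite nth_uniq//; [move=> /eqP|case: ifP => // _; lia].
rewrite !nE//; move: H iS jS s2; move: (size s) => n H iS jS s2.
case: (ltngtP i j) => [ij|ji|->].
- by rewrite H//; case: ifP; case: ifP; lia.
- rewrite (_ : G _ _ <-> G (nth x0 s j) (nth x0 s i)); last by split; exact: Gsym.
  by rewrite H//; case: ifP; case: ifP; lia.
- by split=> [/Girr//|]; case: ifP; lia.
Qed.

Lemma induced_cycle_cycle s : induced_cycle s -> cycle e s.
Proof.
move=> [us sP]; apply: cycle_from_next => // x xs; apply/asboolP/sP => //.
  by rewrite mem_next.
by left.
Qed.

Lemma induced_cycle_nbrs s x : induced_cycle s -> 2 < size s -> x \in s ->
  [/\ G x (next s x), G x (prev s x) & next s x <> prev s x] /\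
  forall y, y \in s -> G x y -> y \in [:: next s x; prev s x].
Proof.
move=> [us sP] s2 xs; split; first split.
- by apply/sP; rewrite ?mem_next//; left.
- by apply/sP; rewrite ?mem_prev//; right; rewrite next_prev.
- move=> np; have [_] := next_neq us s2 xs; apply.
  by rewrite np next_prev.
- move=> y ys /sP -/(_ xs ys)[->|->]; first by rewrite inE eqxx.
  by rewrite prev_next// !inE eqxx orbT.
Qed.

Lemma biconnected_fset_cycle s : uniq s -> cycle e s ->
  biconnected G [set` [fset x in s]%fset].
Proof.
move=> us cs; rewrite (_ : [set` _] = [set` s]); first exact: cycle_biconnected.
by apply/seteqP; split=> z /=; rewrite inE.
Qed.

Lemma even_cycle_choosable s : induced_cycle s -> 2 < size s -> ~~ odd (size s) ->
  degree_choosable Y G [fset x in s]%fset.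
Proof.
move=> cyc s2 sev; have [us sP] := cyc.
apply: (bipartite_choosable y0 graphG (c := fun x => odd (index x s))).
- exact: biconnected_fset_cycle (induced_cycle_cycle cyc).
- move=> x y; rewrite !inE => xs ys /(sP _ _ xs ys)[->|->];
    rewrite odd_index_next//.
    by case: odd.
  by case: odd.
- move=> x; rewrite inE => xs.
  have [[n p np] _] := induced_cycle_nbrs cyc s2 xs.
  apply: (@leq_size_fset _ _ [:: next s x; prev s x]).
    by rewrite /= inE andbT; apply/eqP.
  move=> y; rewrite !inE => /orP[|] /eqP ->; rewrite ?mem_next ?mem_prev xs /=.
    exact/asboolP.
  exact/asboolP.
- by case: s s2 {cyc us sP sev} => // x s _; exists x; rewrite !inE eqxx.
Qed.

(** Without an induced path on three vertices, adjacency to [x] would propagate along every walk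
    from [x]. *)
Lemma not_complete_cherry B : connected_on G B -> ~ complete_on G B ->
  exists u v w, [/\ B u /\ B v, B w, G u v /\ G v w, u <> w & ~ G u w].
Proof.
move=> cB; apply: contra_notP => noch x y xB yB; have := cB x y xB yB.
move=> /clos_rt_rtn1_iff.
elim=> [//|b c [bB cB' bc] _ IH xc].
have [->//|xb] := pselect (x = b).
apply: contrapT => nxc; apply: noch; exists x, b, c; split=> //; split=> //.
exact: IH.
Qed.

(* A shortest path from u to w avoiding v closes up with v into a cycle, all of
   whose chords contain v; a chord makes v of degree > 2 while u has degree 2. *)
Lemma choosable_or_induced_odd_cycle B :
  biconnected G B -> ~ complete_on G B ->
  (exists2 S, [set` S] `<=` B & degree_choosable Y G S) \/
  (exists s, [/\ induced_cycle s, [set` s] `<=` B, odd (size s) & 4 < size s]).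
Proof.
move=> [cB bB] /(not_complete_cherry cB)[u [v [w [[uB vB] wB [uv vw] uw nuw]]]].
have uv' : u <> v by move=> E; apply: (@Girr v); rewrite -{1}E.
have wv' : w <> v by move=> E; apply: (@Girr v); rewrite -{2}E.
have Du : (B `\ v) u by [].
have Dw : (B `\ v) w by [].
have [p [[pp pD] up pw _ pind]] :=
  shortest_path (T := [set w]) Du (erefl w) (bB v vB _ _ Du Dw).
have {pw} pw : last u p = w by [].
(* A single edge would make [u] and [w] adjacent; hence the closed cycle is not a triangle. *)
have p2 : 1 < size p.
  case: p pp pw {pD up pind} => [_ /uw//|a [|b p]]//= /andP[/asboolP ua _] E.
  by case: nuw; rewrite -E.
have us : uniq (v :: u :: p).
  rewrite [uniq _]/= -/(uniq (u :: p)) up andbT.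
  by apply/negP => /pD[_]; apply.
have sB : [set` v :: u :: p] `<=` B.
  by move=> x /=; rewrite inE => /predU1P[->//|/pD[]].
have cs : cycle e (v :: u :: p).
  rewrite /= rcons_path pp pw /=.
  by apply/andP; split; apply/asboolP/Gsym.
(* The ends [u] and [w] of the path are the cyclic neighbours of [v], so a chord at [v] leads
   strictly between them. *)
have [[i /andP[i0 ip] vi]|nochord] :=
    pselect (exists2 i, 0 < i < size p & G v (nth u (u :: p) i)).
  left; exists [fset x in v :: u :: p]%fset.
    by move=> x /=; rewrite !inE => xs; apply: sB; rewrite /= !inE.
  apply: (irregular_choosable y0 graphG (x := u) (y := v)).
  - exact: biconnected_fset_cycle.
  - by rewrite !inE eqxx orbT.
  - by rewrite !inE eqxx.
  - suff [] : #|` nbrs_in G [fset x in v :: u :: p]%fset u| <= 2 /\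
      3 <= #|` nbrs_in G [fset x in v :: u :: p]%fset v| by move=> + + E; rewrite E; lia.
    split.
      apply: (@fset_leq_size _ _ [:: v; nth u p 0]) => y.
      rewrite in_nbrs_in => /andP[+ /asboolP uj].
      rewrite !inE => /predU1P[->|]; first by rewrite eqxx.
      rewrite -in_cons => /(nthP u)[j jp jE]; rewrite -{}jE in uj *.
      case: j jp uj => [_ /= uu|j jp uj]; first by case: (Girr uu).
      by have [->] := pind 0 j.+1 isT jp uj; rewrite /= eqxx orbT.
    apply: (@leq_size_fset _ _ [:: u; nth u (u :: p) i; nth u (u :: p) (size p)]).
      rewrite /= andbT !inE -!/(nth u (u :: p) _) negb_or.
      have nn a b : a < b <= size p -> nth u (u :: p) a != nth u (u :: p) b.
        by move=> ab; rewrite nth_uniq//=; lia.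
      by rewrite (nn 0 i) ?(nn 0 (size p)) ?nn//; lia.
    have inP j : j <= size p -> nth u (u :: p) j \in v :: u :: p.
      by move=> jp; rewrite inE mem_nth ?orbT.
    move=> y; rewrite [y \in [:: _; _; _]]inE => /predU1P[->|].
      rewrite in_nbrs_in !inE eqxx orbT; exact/asboolP/Gsym.
    rewrite inE => /predU1P[->|].
      by rewrite in_nbrs_in mem_fset_seq inP ?(ltnW ip)//=; apply/asboolP.
    rewrite inE => /eqP ->; rewrite in_nbrs_in mem_fset_seq inP//=; apply/asboolP.
    by rewrite -last_nth pw.
have cyc : induced_cycle (v :: u :: p).
  apply: (@induced_cycleI u) => //; first by rewrite /= ltnS ltnW.
  move=> i j ij; rewrite /= => jp.
  case: j ij jp => // j; case: i => [_|i]; rewrite !ltnS.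
    move=> jp; split=> [vj|].
      have [->|j0] := posnP j; first by left.
      right; split => //; have [jlt|] := ltnP j (size p); last by lia.
      by case: nochord; exists j => //; lia.
    case=> [[->]|[_ [->]]]; first exact: Gsym.
    by move: vw; rewrite -pw (last_nth u).
  move=> ij jp; rewrite -!/(nth u (u :: p) _); split=> [/pind|[[->]|[]//]].
    by rewrite ij => /(_ isT)->//; left.
  have /(pathP u)/(_ i (leq_trans ij jp)) := pp => /asboolP.
  exact.
have [sev|sodd] := boolP (odd (size (v :: u :: p))); last first.
  left; exists [fset x in v :: u :: p]%fset; last first.
    by apply: even_cycle_choosable; rewrite //= ltnS ltnW.
  by move=> x /=; rewrite !inE => xs; apply: sB; rewrite /= !inE.
right; exists (v :: u :: p); split => //.
by move: sev p2; rewrite /=; case: (size p) => [|[|[|]]].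
Qed.


(* An ear through b attached at z, chosen so that only its last vertex m has
   neighbours in the rest of the cycle: there the degrees are 2 or 3, while z has
   degree at least 3, and m at least 4 if it is adjacent to all of them. *)
Lemma choosable_of_ear B s : biconnected G B -> induced_cycle s ->
  [set` s] `<=` B -> [set` s] <> B -> 4 < size s ->
  exists2 S, [set` S] `<=` B & degree_choosable Y G S.
Proof.
move=> [cB bB] cyc sB sNB s4; have [us sP] := cyc.
have s2 : 2 < size s by rewrite ltnW// ltnW.
have [b0 [b0B b0s]] : exists b0, B b0 /\ b0 \notin s.
  apply: contrapT => no; apply: sNB; apply/seteqP; split => // x xB.
  by apply: contrapT => /negP xs; apply: no; exists x.
have [z0 z0s] : exists z0, z0 \in s.
  case: s s4 {cyc us sP sB sNB s2 b0s} => // z0 s' _.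
  by exists z0; rewrite inE eqxx.
have [z [b [[zB bB' zb] zs bs]]] := rt_crossing (P := fun x => x \in s)
  (cB _ _ (sB _ z0s) b0B) z0s (negP b0s).
have {bs} /negP bs := bs.
have [n_s nn_s] := next_neq us s2 zs.
set D := B `\` [set` s].
pose T q := D q /\ exists2 z', z' \in s & z' <> z /\ G q z'.
have Db : D b by split => //; apply/negP.
(* Biconnectedness gives a walk from [b] to the cycle that avoids [z]; the vertex just before it
   first enters the cycle lies in [T]. *)
have [q [Tq bq]] : exists q, T q /\ clos_refl_trans X (induced G D) b q.
  have : clos_refl_trans X (induced G (B `\ z)) b (next s z).
    apply: bB => //; split => //.
      by move=> /= E; rewrite E zs in bs.
    by apply: sB; rewrite /= mem_next.
  move=> /clos_rt_rt1n_iff; set t := next s z => bt.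
  have ts : t \in s by rewrite mem_next.
  elim: bt Db ts {bs zb bB'} => {b t n_s nn_s}
    [t [_ nt] ts|a c t [[aB az] [cB' cz] ac] _ IH Da ts].
    by case: nt.
  have [cs|/negP cs] := boolP (c \in s).
    by exists a; split; [split => //; exists c|exact: rt_refl].
  have Dc : D c by split.
  have [q [Tq cq]] := IH Dc ts; exists q; split=> //.
  by apply: rt_trans cq; apply: rt_step.
have [p [[pp pD] up pT pnT _]] := shortest_path Db Tq bq.
set m := last b p in pT.
have [Dm [z' z's [z'z mz']]] := pT.
have bp_s x : x \in b :: p -> x \in s = false.
  by move=> /pD[_ xs]; apply/negP.
have only_m x y : x \in b :: p -> y \in s -> y <> z -> G x y -> x = m.
  move=> /(nthP b)[i ip <-] ys yz xy.
  have [ilt|] := ltnP i (size p).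
    case: (pnT i ilt); split; last by exists y.
    by apply: pD; rewrite mem_nth.
  move=> pi; rewrite /m (last_nth b); congr nth; apply/eqP.
  by rewrite eqn_leq pi andbT.
set F := [fset x in s ++ b :: p]%fset.
have FB : [set` F] `<=` B.
  move=> x /=; rewrite mem_fset_seq mem_cat => /orP[/sB//|/pD[]//].
have biF : biconnected G [set` F].
  (* [F] is a union of two cycles sharing [z] and [z']: the cycle [s], and the ear closed up by an
     arc of [s] from [z'] to [z]. *)
  have [i r def_r] := rot_to z's.
  have rs x : (x \in z' :: r) = (x \in s) by rewrite -def_r mem_rot.
  have ur : uniq (z' :: r) by rewrite -def_r rot_uniq.
  have cr : cycle e (z' :: r) by rewrite -def_r rot_cycle; exact: induced_cycle_cycle.
  have zr : z \in r.
    by move: zs; rewrite -rs inE => /predU1P[/esym|].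
  move: {def_r} ur cr rs; case/splitPr: zr => a1 a2 ur cr rs.
  have ur' : uniq (z' :: a1 ++ z :: b :: p).
    have : uniq ((z' :: a1 ++ [:: z]) ++ b :: p).
      rewrite cat_uniq up andbT; apply/andP; split.
        move: ur; rewrite -cat_rcons -cats1 -cat_cons cat_uniq => /andP[].
        by [].
      apply/hasPn => x xbp; apply/negP => xr.
      have : x \in s.
        by rewrite -rs -cat_rcons -cats1 -cat_cons mem_cat xr.
      by rewrite bp_s.
    by rewrite cat_cons -catA.
  have cr' : cycle e (z' :: a1 ++ z :: b :: p).
    move: cr; rewrite /= !rcons_cat !cat_path /= !rcons_path -/m.
    move=> /andP[-> /andP[-> _]] /=; rewrite pp /=.
    by apply/andP; split; apply/asboolP.
  have -> : [set` F] = [set` s] `|` [set` z' :: a1 ++ z :: b :: p].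
    apply/seteqP; split=> x /=.
      rewrite mem_fset_seq mem_cat => /orP[|xbp]; [by left|right].
      rewrite inE mem_cat [_ \in z :: _]inE xbp; by rewrite !orbT.
    rewrite mem_fset_seq mem_cat => -[->//|].
    rewrite inE mem_cat [_ \in z :: _]inE => /or4P[/eqP ->|xa|/eqP ->|->].
    - by rewrite z's.
    - by rewrite -rs inE mem_cat xa orbT.
    - by rewrite zs.
    - by rewrite orbT.
  apply: (biconnected_union graphG (x := z) (y := z')) => //=.
  - exact/cycle_biconnected/induced_cycle_cycle.
  - exact: cycle_biconnected.
  - by rewrite inE mem_cat inE eqxx !orbT.
  - by rewrite inE eqxx.
  - exact/nesym.
have sF x : x \in s -> x \in F by rewrite mem_fset_seq mem_cat => ->.
have bpF x : x \in b :: p -> x \in F by rewrite mem_fset_seq mem_cat => ->; rewrite orbT.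
have mbp : m \in b :: p by exact: mem_last.
have degz : 3 <= #|` nbrs_in G F z|.
  have [[zn zp np] _] := induced_cycle_nbrs cyc s2 zs.
  apply: (@leq_size_fset _ _ [:: next s z; prev s z; b]).
    rewrite /= !inE negb_or andbT -andbA; apply/and3P; split.
    - exact/eqP.
    - by apply: contraNneq bs => <-; rewrite mem_next.
    - by apply: contraNneq bs => <-; rewrite mem_prev.
  apply/(@allP _ (mem (nbrs_in G F z))); rewrite /= !in_nbrs_in.
  rewrite (sF (next s z)) ?mem_next// (sF (prev s z)) ?mem_prev// (bpF b) ?mem_head//.
  by rewrite andbT; apply/and3P; split; apply/asboolP.
have degs x : x \in s -> x <> z ->
    {subset nbrs_in G F x <= [:: next s x; prev s x] ++
      (if `[<G x m>] then [:: m] else [::])}.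
  move=> xs xz y; rewrite in_nbrs_in mem_fset_seq !mem_cat => /andP[yF /asboolP xy].
  have [_ nb] := induced_cycle_nbrs cyc s2 xs.
  case/orP: yF => [/nb->//|ybp].
  have ym : y = m by apply: (only_m _ x) => //; exact: Gsym.
  by rewrite -ym asboolT// mem_head orbT.
exists F => //.
have [[x xs [xz xm]]|allm] := pselect (exists2 x, x \in s & x <> z /\ ~ G x m).
  apply: (irregular_choosable y0 graphG (x := x) (y := z)) => //; [exact: sF|exact: sF|].
  have := fset_leq_size (degs x xs xz); rewrite asboolF//= => H E.
  by move: degz; rewrite -E ltnNge H.
apply: (irregular_choosable y0 graphG (x := z') (y := m)) => //; [exact: sF|exact: bpF|].
have := fset_leq_size (degs _ z's z'z); rewrite asboolT/=; last exact: Gsym.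
(* Here [4 < size s] counts: [m] has at least [size s - 1] neighbours, while [z'] has at most
   three. *)
have : size (rem z s) <= #|` nbrs_in G F m|.
  apply: leq_size_fset; first exact: rem_uniq.
  move=> x; rewrite mem_rem_uniq// inE => /andP[/eqP xz xs].
  rewrite in_nbrs_in sF//=; apply/asboolP/Gsym; apply: contrapT => xm.
  by apply: allm; exists x.
rewrite size_rem// => H1 H2 E; move: H1; rewrite -E => H1.
by have := leq_trans H1 H2; rewrite leqNgt; case: (size s) s4 => [|[|[|[|[|]]]]].
Qed.

(** An induced odd cycle filling [B] is excluded by hypothesis, so otherwise a vertex of [B] is left
    from which to grow an ear. *)
Theorem exists_choosable B : biconnected G B -> ~ complete_on G B ->
  ~ odd_cycle_on G B -> exists2 S, [set` S] `<=` B & degree_choosable Y G S.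
Proof.
move=> biB ncB noB; have [//|[s [cyc sB sodd s4]]] :=
  choosable_or_induced_odd_cycle biB ncB.
apply: (choosable_of_ear biB cyc sB _ s4) => sE; apply: noB.
exists s; case: cyc => us sP; split; last by split.
by split=> //; rewrite ltnW// ltnW.
Qed.

End gallai.

(** * Analytic sets and countable sections *)

Section sigma_algebra_predicates.
Variables (X : Type) (SX : set (set X)).
Hypothesis sX : sigma_algebra [set: X] SX.
Implicit Types P Q : X -> Prop.

Lemma sa_not P : SX [set x | P x] -> SX [set x | ~ P x].
Proof. by case: sX => _ + _ => /[apply]; rewrite setTD. Qed.

Lemma sa_notE P : SX [set x | ~ P x] -> SX [set x | P x].
Proof.
move=> /sa_not; congr SX; apply/seteqP; split=> x /=; last by move=> Px nPx; exact: nPx.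
exact: contrapT.
Qed.

Lemma sa_ex_nat (P : nat -> X -> Prop) :
  (forall n, SX [set x | P n x]) -> SX [set x | exists n, P n x].
Proof.
case: sX => _ _ /[apply]; congr SX; apply/seteqP; split=> x /=.
  by case=> n _ Pn; exists n.
by case=> n Pn; exists n.
Qed.

Lemma sa_const (b : Prop) : SX [set x | b].
Proof.
have s0 : SX set0 by case: sX.
have [bT|bF] := pselect b.
  suff -> : [set x : X | b] = [set x | ~ set0 x] by exact: sa_not.
  by apply/seteqP; split=> x //= _; exact.
rewrite (_ : [set x : X | b] = set0)//.
by apply/seteqP; split=> x.
Qed.

Lemma sa_ex (I : countType) (P : I -> X -> Prop) :
  (forall i, SX [set x | P i x]) -> SX [set x | exists i, P i x].
Proof.
move=> sP; pose Q n x := if @choice.unpickle I n is Some i then P i x else False.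
have := @sa_ex_nat Q; rewrite (_ : [set x | _] = [set x | exists i, P i x]).
  by apply=> n; rewrite /Q; case: choice.unpickle => [i|]; [exact: sP|exact: sa_const].
apply/seteqP; split=> x /= [n].
  by rewrite /Q; case: choice.unpickle => // i Pi; exists i.
by move=> Pn; exists (choice.pickle n); rewrite /Q choice.pickleK.
Qed.

Lemma sa_all (I : countType) (P : I -> X -> Prop) :
  (forall i, SX [set x | P i x]) -> SX [set x | forall i, P i x].
Proof.
move=> sP; apply: sa_notE.
rewrite (_ : [set x | _] = [set x | exists i, ~ P i x]).
  by apply: sa_ex => i; apply: sa_not.
by apply/seteqP; split=> x /=; [move/existsNP|case=> i + /(_ i)].
Qed.

Lemma sa_or P Q : SX [set x | P x] -> SX [set x | Q x] ->
  SX [set x | P x \/ Q x].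
Proof.
move=> sP sQ; have := @sa_ex bool (fun b x => if b then P x else Q x).
rewrite (_ : [set x | _] = [set x | P x \/ Q x]); first by apply; case.
apply/seteqP; split=> x /= [].
- by case; [left|right].
- by exists true.
- by exists false.
Qed.

Lemma sa_and P Q : SX [set x | P x] -> SX [set x | Q x] ->
  SX [set x | P x /\ Q x].
Proof.
move=> sP sQ; have := @sa_all bool (fun b x => if b then P x else Q x).
rewrite (_ : [set x | _] = [set x | P x /\ Q x]); first by apply; case.
apply/seteqP; split=> x /=; first by move=> h; have := h true; have := h false.
by move=> [? ?] [].
Qed.

Lemma sa_imp P Q : SX [set x | P x] -> SX [set x | Q x] ->
  SX [set x | P x -> Q x].
Proof.
move=> sP sQ; rewrite (_ : [set x | _] = [set x | ~ P x \/ Q x]).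
  by apply: sa_or => //; apply: sa_not.
apply/seteqP; split=> x /=; last by case.
by have [Px /(_ Px)|] := pselect (P x); [right|left].
Qed.

Lemma sa_all_in (I : countType) (s : seq I) (P : I -> X -> Prop) :
  (forall i, i \in s -> SX [set x | P i x]) ->
  SX [set x | forall i, i \in s -> P i x].
Proof.
move=> sP; apply: sa_all => i; have [/sP//|is_] := boolP (i \in s).
  by move=> ?; apply: sa_imp => //; apply: sa_const.
by rewrite (_ : [set x | _] = [set x | True]); [exact: sa_const|exact/seteqP].
Qed.

Lemma sa_countable (I : countType) (f : X -> I) (A : I -> Prop) :
  (forall i, SX [set x | f x = i]) -> SX [set x | A (f x)].
Proof.
move=> sf; rewrite (_ : [set x | _] = [set x | exists i, f x = i /\ A i]).
  by apply: sa_ex => i; apply: sa_and => //; apply: sa_const.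
by apply/seteqP; split=> x /= => [?|[i [<-]]//]; exists (f x).
Qed.

(** Splitting over the countably many values of [f] makes joint measurability in the index and the
    point unnecessary. *)
Lemma sa_subst (I : countType) (f : X -> I) (P : I -> X -> Prop) :
  (forall i, SX [set x | f x = i]) -> (forall i, SX [set x | P i x]) ->
  SX [set x | P (f x) x].
Proof.
move=> sf sP; rewrite (_ : [set x | _] = [set x | exists i, f x = i /\ P i x]).
  by apply: sa_ex => i; apply: sa_and.
by apply/seteqP; split=> x /= => [?|[i [<-]]//]; exists (f x).
Qed.

(** Together with [least_exists] this is the uniformisation principle behind all Borel choices of an
    index. *)
Lemma sa_minimal (P : nat -> X -> Prop) (f : X -> nat) :
  (forall n, SX [set x | P n x]) ->
  (forall x, P (f x) x /\ forall n, P n x -> f x <= n) ->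
  forall n, SX [set x | f x = n].
Proof.
move=> sP fP n.
rewrite (_ : [set x | _] = [set x | P n x /\ forall i : 'I_n, ~ P i x]).
  by apply: sa_and => //; apply: sa_all => i; apply: sa_not.
apply/seteqP; split=> x /=.
  move=> <-; split; first by case: (fP x).
  by move=> i /(fP x).2; rewrite leqNgt ltn_ord.
move=> [Pn nP]; apply/eqP; rewrite eqn_leq (fP x).2//= leqNgt; apply/negP => fn.
exact: (nP (Ordinal fn)) (fP x).1.
Qed.

End sigma_algebra_predicates.

Lemma least_exists (X : Type) (P : nat -> X -> Prop) :
  (forall x, exists n, P n x) ->
  exists f, forall x, P (f x) x /\ forall n, P n x -> f x <= n.
Proof.
move=> exP; suff /choice[f fP] : forall x, exists m,
    P m x /\ forall n, P n x -> m <= n by exists f.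
move=> x; have [|m /asboolP Pm min] := @ex_minnP (fun n => `[<P n x>]).
  by have [n Pn] := exP x; exists n; apply/asboolP.
by exists m; split => // n Pn; apply: min; apply/asboolP.
Qed.

Lemma borel_sigma_algebra (T : topologicalType) :
  sigma_algebra [set: T] (borel T).
Proof. exact: smallest_sigma_algebra. Qed.

Lemma borel_open (T : topologicalType) (U : set T) : open U -> borel T U.
Proof. exact: sub_gen_smallest. Qed.

Lemma borel_preimage (T T' : topologicalType) (f : T -> T') (B : set T') :
  continuous f -> borel T' B -> borel T (f @^-1` B).
Proof.
move=> cf; apply: (smallest_sub (X := [set B | borel T (f @^-1` B)])).
  have sT := borel_sigma_algebra T; split=> /=.
  - by rewrite preimage_set0; case: sT.
  - by move=> A bA; rewrite setTD preimage_setC -setTD; case: sT => _ + _; exact.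
  - by move=> A; case: sT => _ _ /[apply]; rewrite preimage_bigcup.
by move=> U oU; apply: borel_open; apply: open_comp => // x _; exact: cf.
Qed.

(** * Baire space and analytic sets *)

Section baire.
Implicit Types (a b : nat -> nat).

(* Closed subsets of Baire space and continuous maps on them, in terms of initial
   segments. *)
Definition agree n a b : Prop := forall i, i < n -> a i = b i.

Definition bclosed (F : set (nat -> nat)) : Prop :=
  forall a, (forall n, exists2 b, F b & agree n a b) -> F a.

Definition bcont (T : topologicalType) (F : set (nat -> nat))
    (f : (nat -> nat) -> T) : Prop :=
  forall a, F a -> forall U, open U -> U (f a) ->
    exists n, forall b, F b -> agree n a b -> U (f b).

(** With a closed set as domain, the empty set is covered, and an intersection can be coded by the
    closed set of compatible sequences. *)
Definition analytic (T : topologicalType) (A : set T) : Prop :=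
  exists F f, [/\ bclosed F, @bcont T F f & A = f @` F].

Lemma agree_le m n a b : m <= n -> agree n a b -> agree m a b.
Proof. by move=> mn ab i im; apply: ab; apply: leq_trans mn. Qed.

(** One sequence codes countably many: the [k]-th is read at the positions paired with [k]. *)
Definition bproj (k : nat) a : nat -> nat := fun i => a (choice.pickle (k, i)).

Lemma agree_bproj k n : exists N, forall a b, agree N a b ->
  agree n (bproj k a) (bproj k b).
Proof.
exists (\max_(i < n) (choice.pickle (k, nat_of_ord i))).+1 => a b ab i i_n; apply: ab.
rewrite ltnS; apply: (@leq_bigmax _
  (fun i : 'I_n => choice.pickle (k, nat_of_ord i)) (Ordinal i_n)).
Qed.

Definition bmerge (c : nat -> nat -> nat) : nat -> nat :=
  fun n => if @choice.unpickle (nat * nat)%type n is Some p then c p.1 p.2 else 0.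

Lemma bproj_merge k c : bproj k (bmerge c) = c k.
Proof. by apply/funext => i; rewrite /bproj /bmerge choice.pickleK. Qed.

Lemma agree_behead n a b : agree n.+1 a b -> agree n (a \o succn) (b \o succn).
Proof. by move=> ab i i_n; apply: ab. Qed.

End baire.

Section analytic_sets.
Variables (T : topologicalType) (t0 : T).
Implicit Types (A B : set T).

(** The first entry of a code selects the set, and the tail codes a point of it. *)
Lemma analytic_bigcup (A : nat -> set T) :
  (forall n, analytic (A n)) -> analytic (\bigcup_n A n).
Proof.
move=> /choice[F /choice[f fP]].
exists (fun a => F (a 0) (a \o succn)), (fun a => f (a 0) (a \o succn)); split.
- move=> a cla; have [cl _ _] := fP (a 0); apply: cl => n.
  have [b Fb ab] := cla n.+1; exists (b \o succn); last exact: agree_behead.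
  by rewrite (ab 0).
- move=> a Fa U oU Ua; have [_ ct _] := fP (a 0).
  have [n nP] := ct _ Fa U oU Ua; exists n.+1 => b Fb ab.
  by rewrite -(ab 0)// in Fb *; apply: nP => //; exact: agree_behead.
- apply/seteqP; split=> t /=.
    move=> [n _]; have [_ _ ->] := fP n => -[a Fa <-].
    by exists (fun i => if i is j.+1 then a j else n).
  move=> [a Fa <-]; exists (a 0) => //; have [_ _ ->] := fP (a 0).
  by exists (a \o succn).
Qed.

(** A code consists of codes of one and the same point, one for each set. The Hausdorff property
    makes this coincidence a closed condition. *)
Lemma analytic_bigcap (A : nat -> set T) : hausdorff_space T ->
  (forall n, analytic (A n)) -> analytic (\bigcap_n A n).
Proof.
rewrite open_hausdorff => hT /choice[F /choice[f fP]].
have cl k : bclosed (F k) by have [] := fP k.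
have ct k : bcont (F k) (f k) by have [] := fP k.
exists (fun a => forall k, F k (bproj k a) /\ f k (bproj k a) = f 0 (bproj 0 a)),
  (fun a => f 0 (bproj 0 a)); split.
- move=> a cla; have Fa k : F k (bproj k a).
    apply: cl => n; have [N NP] := agree_bproj k n.
    have [b Fb ab] := cla N; exists (bproj k b); last exact: NP.
    by case: (Fb k).
  move=> k; split => //; apply/eqP; apply: contrapT => /negP /hT.
  case=> -[U V] /= [/[!inE] Uk V0] [oU oV UV].
  have [m mP] := ct k _ (Fa k) U oU Uk; have [n nP] := ct 0 _ (Fa 0) V oV V0.
  have [M MP] := agree_bproj k m; have [N NP] := agree_bproj 0 n.
  have [b Fb ab] := cla (maxn M N).
  suff : (U `&` V) (f 0 (bproj 0 b)) by rewrite UV.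
  split; last first.
    apply: nP; first by case: (Fb 0).
    by apply: NP; apply: agree_le ab; exact: leq_maxr.
  have [Fkb <-] := Fb k; apply: mP => //.
  by apply: MP; apply: agree_le ab; exact: leq_maxl.
- move=> a Fa U oU Ua; have [F0 _] := Fa 0.
  have [n nP] := ct 0 _ F0 U oU Ua; have [N NP] := agree_bproj 0 n.
  by exists N => b Fb ab; apply: nP; [case: (Fb 0)|exact: NP].
- apply/seteqP; split=> t /=.
    move=> At; have /choice[c cP] : forall k, exists a, F k a /\ f k a = t.
      by move=> k; have := At k I; have [_ _ ->] := fP k => -[a Fa <-]; exists a.
    exists (bmerge c); last by rewrite bproj_merge; case: (cP 0).
    by move=> k; rewrite !bproj_merge (cP k).2 (cP 0).2; split => //; case: (cP k).
  move=> [a Fa <-] k _; have [_ _ ->] := fP k; exists (bproj k a); by case: (Fa k).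
Qed.

Lemma analytic_set0 : analytic (set0 : set T).
Proof.
exists set0, (fun=> t0); split.
- by move=> a /(_ 0)[].
- by [].
- by rewrite image_set0.
Qed.

Lemma analytic_ex (I : countType) (P : I -> T -> Prop) :
  (forall i, analytic [set x | P i x]) -> analytic [set x | exists i, P i x].
Proof.
move=> aP; rewrite (_ : [set x | _] = \bigcup_n
    [set x | if @choice.unpickle I n is Some i then P i x else False]).
  by apply: analytic_bigcup => n; case: choice.unpickle => //; exact: analytic_set0.
apply/seteqP; split=> x /=.
  by move=> [i Pi]; exists (choice.pickle i); rewrite //= choice.pickleK.
by move=> [n _] /=; case: choice.unpickle => // i; exists i.
Qed.

Lemma analytic_setU A B : analytic A -> analytic B -> analytic (A `|` B).
Proof.
move=> aA aB; rewrite -bigcup2E; apply: analytic_bigcup => -[|[|n]] //=.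
exact: analytic_set0.
Qed.

Lemma analytic_setI A B : hausdorff_space T ->
  analytic A -> analytic B -> analytic (A `&` B).
Proof.
move=> hT aA aB.
rewrite (_ : A `&` B = \bigcap_n (if n == 0 then A else B)).
  by apply: analytic_bigcap => // n; case: ifP.
apply/seteqP; split=> t; first by move=> [At Bt] n _; case: ifP.
by move=> h; split; [exact: (h 0 I)|exact: (h 1 I)].
Qed.

Lemma analytic_all_in (I : eqType) (s : seq I) (P : I -> T -> Prop) :
  hausdorff_space T -> analytic [set: T] ->
  (forall i, analytic [set x | P i x]) ->
  analytic [set x | forall i, i \in s -> P i x].
Proof.
move=> hT aT aP; elim: s => [|i s IHs].
  by rewrite (_ : [set x | _] = setT)//; apply/seteqP; split.
rewrite (_ : [set x | _] = [set x | P i x] `&`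
    [set x | forall i, i \in s -> P i x]); first exact: analytic_setI.
apply/seteqP; split=> x /=.
  move=> h; split; first by apply: h; rewrite inE eqxx.
  by move=> j js; apply: h; rewrite inE js orbT.
by move=> [Pi h] j; rewrite inE => /predU1P[->//|/h].
Qed.

Lemma analytic_image (T' : topologicalType) (h : T -> T') A :
  continuous h -> analytic A -> analytic (h @` A).
Proof.
move=> ch [F [f [cl ct ->]]]; exists F, (h \o f); split => //.
  move=> a Fa U oU Ua; apply: (ct a Fa (h @^-1` U)) => //.
  by apply: open_comp => // x _; exact: ch.
by rewrite image_comp.
Qed.

Lemma analytic_setX (T' : topologicalType) A (B : set T') :
  analytic A -> analytic B -> analytic (A `*` B).
Proof.
move=> [F [f [clF ctF ->]]] [H [h [clH ctH ->]]].
exists (fun a => F (bproj 0 a) /\ H (bproj 1 a)),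
  (fun a => (f (bproj 0 a), h (bproj 1 a))); split.
- move=> a cla; split; [apply: clF|apply: clH] => n;
    [have [N NP] := agree_bproj 0 n|have [N NP] := agree_bproj 1 n];
    have [b [Fb Hb] ab] := cla N; eexists; [exact: Fb|exact: NP|exact: Hb|exact: NP].
- move=> a [Fa Ha] U oU Ua.
  have : nbhs (f (bproj 0 a), h (bproj 1 a)) U by apply: open_nbhs_nbhs.
  case=> -[V W] /= [+ +] VWU; rewrite !nbhsE => -[V' [oV' V'a] V'V] [W' [oW' W'a] W'W].
  have [m mP] := ctF _ Fa V' oV' V'a; have [n nP] := ctH _ Ha W' oW' W'a.
  have [M MP] := agree_bproj 0 m; have [N NP] := agree_bproj 1 n.
  exists (maxn M N) => b [Fb Hb] ab; apply: VWU; split=> /=.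
    apply/V'V/mP => //; apply: MP; apply: agree_le ab; exact: leq_maxl.
  apply/W'W/nP => //; apply: NP; apply: agree_le ab; exact: leq_maxr.
- apply/seteqP; split=> -[s t] /=.
    move=> [[a Fa <-] [b Hb <-]]; exists (bmerge (fun k => if k == 0 then a else b)).
      by rewrite !bproj_merge.
    by rewrite !bproj_merge.
  by move=> [a [Fa Ha] [<- <-]]; split; [exists (bproj 0 a)|exists (bproj 1 a)].
Qed.

End analytic_sets.

(** * Lusin separation *)

Section lusin.
Variables (T : topologicalType).

Definition borel_separated (A B : set T) : Prop :=
  exists C, [/\ borel T C, A `<=` C & B `<=` ~` C].

Lemma borel_separated_bigcup (A B : nat -> set T) :
  (forall m n, borel_separated (A m) (B n)) ->
  borel_separated (\bigcup_m A m) (\bigcup_n B n).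
Proof.
move=> sepAB; have /choice[C CP] : forall p : nat * nat, exists C,
  [/\ borel T C, A p.1 `<=` C & B p.2 `<=` ~` C] by move=> p; exact: sepAB.
exists [set x | exists m, forall n, C (m, n) x]; split.
- apply: (sa_ex (borel_sigma_algebra T)) => m.
  by apply: (sa_all (borel_sigma_algebra T)) => n; case: (CP (m, n)).
- by move=> x [m _ Ax]; exists m => n; case: (CP (m, n)) => _ + _; apply.
- move=> x [n _ Bx] [m Cx]; case: (CP (m, n)) => _ _ /(_ x Bx); apply.
  exact: Cx.
Qed.

Definition cylinder (s : seq nat) : set (nat -> nat) :=
  [set a | forall i, i < size s -> a i = nth 0 s i].

Lemma cylinder_rcons s : cylinder s = \bigcup_k cylinder (rcons s k).
Proof.
apply/seteqP; split=> a /=.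
  move=> sa; exists (a (size s)) => // i; rewrite size_rcons ltnS leq_eqVlt nth_rcons.
  case/predU1P => [->|is_]; first by rewrite ltnn eqxx.
  by rewrite is_ sa.
move=> [k _ sa] i is_; have := sa i; rewrite size_rcons nth_rcons is_; apply.
by rewrite ltnS ltnW.
Qed.

(* If two analytic sets cannot be separated, neither can their pieces along some
   pair of branches; continuity at the branches separates those by open sets. *)
Theorem lusin_separation (A B : set T) : hausdorff_space T ->
  analytic A -> analytic B -> A `&` B = set0 -> borel_separated A B.
Proof.
rewrite open_hausdorff => hT [F [f [clF ctF AE]]] [H [h [clH ctH BE]]] AB0.
pose P s := f @` (F `&` cylinder s); pose Q s := h @` (H `&` cylinder s).
have PU s : P s = \bigcup_k P (rcons s k).
  by rewrite /P {1}cylinder_rcons setI_bigcupr image_bigcup.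
have QU s : Q s = \bigcup_k Q (rcons s k).
  by rewrite /Q {1}cylinder_rcons setI_bigcupr image_bigcup.
have cyl0 : cylinder [::] = setT by apply/seteqP.
have -> : A = P [::] by rewrite /P cyl0 setIT.
have -> : B = Q [::] by rewrite /Q cyl0 setIT.
apply: contrapT => nsep.
(* The nodes are pairs of words with inseparable pieces; [borel_separated_bigcup] provides an
   inseparable pair among the one-letter extensions. *)
pose st := {p : seq nat * seq nat | ~ borel_separated (P p.1) (Q p.2)}.
have step (p : st) : exists q : st, exists k l,
    sval q = (rcons (sval p).1 k, rcons (sval p).2 l).
  case: p => -[s t] /= np.
  have [k [l kl]] : exists k l, ~ borel_separated (P (rcons s k)) (Q (rcons t l)).
    apply: contrapT => no; apply: np; rewrite PU QU.
    apply: borel_separated_bigcup => m n; apply: contrapT => nmn.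
    by apply: no; exists m, n.
  by exists (exist _ (rcons s k, rcons t l) kl), k, l.
have [g gP] := choice step.
pose p0 : st := exist _ ([::], [::]) nsep.
pose p n := sval (iter n g p0).
pose a n := last 0 (p n.+1).1; pose b n := last 0 (p n.+1).2.
have pE n : p n = (mkseq a n, mkseq b n).
  elim: n => [//|n IHn]; have [k [l kl]] := gP (iter n g p0).
  have pS : p n.+1 = (rcons (p n).1 k, rcons (p n).2 l) by [].
  have ak : a n = k by rewrite /a pS last_rcons.
  have bl : b n = l by rewrite /b pS last_rcons.
  by rewrite pS IHn /= !mkseqS ak bl.
have nsepn n : ~ borel_separated (P (mkseq a n)) (Q (mkseq b n)).
  by have := svalP (iter n g p0); rewrite -/(p n) pE.
have cyl_mkseq c n d : cylinder (mkseq c n) d -> agree n c d.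
  by move=> cd i i_n; have := cd i; rewrite size_mkseq nth_mkseq// => ->.
(* If no code in [F] agreed with [a] on [n] entries, the corresponding piece of [A] would be empty
   and hence separated. *)
have Fa : F a.
  apply: clF => n; apply: contrapT => no; apply: (nsepn n).
  exists set0; split; [by case: (borel_sigma_algebra T)| |by move=> ? _ []].
  by move=> x [c [Fc /cyl_mkseq ac] _]; case: no; exists c.
have Hb : H b.
  apply: clH => n; apply: contrapT => no; apply: (nsepn n).
  exists setT; split; [by apply: borel_open; exact: openT|by []|].
  by move=> x [c [Fc /cyl_mkseq ac] _]; case: no; exists c.
have /hT[[U V] /= [/[!inE] Ua Vb] [oU oV UV]] : f a != h b.
  apply/eqP => E; suff : (A `&` B) (f a) by rewrite AB0.
  by split; [rewrite AE; exists a|rewrite BE E; exists b].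
have [m mP] := ctF a Fa U oU Ua; have [n nP] := ctH b Hb V oV Vb.
apply: (nsepn (maxn m n)); exists U; split; first exact: borel_open.
  move=> x [c [Fc /cyl_mkseq ac] <-]; apply: mP => //.
  by apply: agree_le ac; exact: leq_maxl.
move=> x [c [Hc /cyl_mkseq ac] <-] /= Ux; suff : (U `&` V) (h c) by rewrite UV.
by split => //; apply: nP => //; apply: agree_le ac; exact: leq_maxr.
Qed.

(** Suslin's theorem: a set separating [A] from its complement can only be [A]. *)
Lemma analytic_borel (A : set T) : hausdorff_space T ->
  analytic A -> analytic (~` A) -> borel T A.
Proof.
move=> hT aA aC; have [C [bC AC CA]] := lusin_separation hT aA aC (setICr A).
suff -> : A = C by [].
apply/seteqP; split => // x Cx; apply: contrapT => Ax; exact: CA Ax Cx.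
Qed.

End lusin.

(** * Polish and standard Borel spaces *)

Section complete_metric_spaces.
Import Order.TTheory GRing.Theory Num.Theory.
Local Open Scope ring_scope.

Lemma pow2V_gt0 (R : realType) k : 0 < 2 ^- k :> R.
Proof. by rewrite invr_gt0 exprn_gt0. Qed.

Lemma pow2VS (R : realType) k : 2 ^- k = 2 * 2 ^- k.+1 :> R.
Proof. by rewrite exprS invfM mulrA divff ?pnatr_eq0// mul1r. Qed.

Lemma pow2V_lt (R : realType) (e : R) : 0 < e -> exists k, 2 ^- k < e.
Proof.
move=> e0; exists (Num.truncn e^-1).+1; rewrite -[ltRHS]invrK.
rewrite ltf_pV2 ?posrE ?exprn_gt0 ?invr_gt0//; apply: lt_trans (truncnS_gt _) _.
by rewrite -natrX ltr_nat ltn_expl.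
Qed.

Section metric.
Variables (R : realType) (M : metricType R).
Implicit Types (x y : M) (u : nat -> M).

Lemma mdist_small x y c : (forall k, mdist x y <= c * 2 ^- k) -> x = y.
Proof.
move=> h; apply: mdist_positivity; apply/eqP; rewrite eq_le mdist_ge0 andbT.
rewrite leNgt; apply/negP => d0.
have c0 : 0 < c.
  by have := lt_le_trans d0 (h 0); rewrite pmulr_lgt0// pow2V_gt0.
have [k] := pow2V_lt (divr_gt0 d0 c0).
by rewrite ltr_pdivlMr// ltNge mulrC h.
Qed.

Lemma fast_cauchy u : (forall k, mdist (u k) (u k.+1) < 2 ^- k) ->
  forall k j, mdist (u k) (u (k + j)%N) <= 2 * 2 ^- k.
Proof.
move=> hu k j.
(* The sharper bound is the partial geometric sum, which the induction on [j] needs. *)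
suff : mdist (u k) (u (k + j)%N) <= 2 * 2 ^- k - 2 * 2 ^- (k + j).
  by move=> /le_trans; apply; rewrite gerBl mulr_ge0// ltW// pow2V_gt0.
elim: j => [|j IHj]; first by rewrite addn0 mdistxx subrr.
rewrite addnS; apply: le_trans (metric_triangle _ (u (k + j)%N) _) _.
have := hu (k + j)%N; have := @pow2VS R (k + j); move: IHj.
move: (mdist _ _) (mdist _ _) (2 ^- k) (2 ^- (k + j)) (2 ^- (k + j).+1) => a b c d e.
by move=> H1 E H2; lra.
Qed.

Lemma fast_cauchy_limit u : complete_uniform M ->
  (forall k, mdist (u k) (u k.+1) < 2 ^- k) ->
  exists x, forall k, mdist (u k) x <= 4 * 2 ^- k.
Proof.
move=> cM hu; have fu := fast_cauchy hu.
have cau : cauchy (u @ \oo).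
  apply: cauchy_exP => e e0.
  have [k] := @pow2V_lt R (e / 2) ltac:(by rewrite divr_gt0).
  rewrite ltr_pdivlMr// mulrC => ke.
  exists (u k); exists k => // n /= kn; rewrite ballEmdist /=.
  by rewrite -(subnKC kn) (le_lt_trans (fu _ _)).
have [x ux] := cM _ _ cau; exists x => k.
(* Some later term is within [2 * 2 ^- k] of the limit and, by [fast_cauchy], equally close to
   [u k]; hence the constant 4. *)
have : 0 < 2 * 2 ^- k :> R by rewrite mulr_gt0// pow2V_gt0.
move=> /(metricType_numDomainType.cvgr_dist_lt ux)[n _ nP].
have := nP (k + n)%N (leq_addl _ _) => /= H.
apply: le_trans (metric_triangle _ (u (k + n)%N) _) _.
have := fu k n; rewrite metric_sym in H; move: H.
move: (mdist _ _) (mdist _ _) (2 ^- k) => a b c; lra.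
Qed.

Definition dense_seq (d : nat -> M) : Prop :=
  forall x e, 0 < e -> exists n, mdist x (d n) < e.

Lemma separable_dense_seq (x0 : M) : separable M -> exists d, dense_seq d.
Proof.
move=> [D /countable_injP[f] fI dD].
pose d n := if pselect (exists2 x, D x & f x = n) is left h then sval (cid2 h) else x0.
exists d => x e e0; have [y [xy Dy]] : ball x e `&` D !=set0.
  have [y [yo Dy]] : interior (ball x e) `&` D !=set0.
    apply: dD; last exact: open_interior.
    by exists x; exact: nbhsx_ballx.
  by exists y; split => //; exact: interior_subset.
exists (f y); rewrite /d; case: pselect => [h|[]]; last by exists y.
case: cid2 => z Dz fz /=; have -> : z = y by apply: fI; rewrite ?inE.
by move: xy; rewrite ballEmdist.
Qed.

Lemma open_mball x (r : R) : open [set y | mdist x y < r].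
Proof.
rewrite openE => y /= xy; rewrite /interior.
rewrite -metricType_numDomainType.filter_from_mdist_nbhs.
exists (r - mdist x y); rewrite /= ?subr_gt0// => z /= yz.
by rewrite (le_lt_trans (metric_triangle _ y _))// -ltrBrDl.
Qed.

(* A point is coded by a fast Cauchy sequence of elements of the dense sequence;
   the codes form a closed set on which taking limits is continuous. *)
Theorem analytic_complete : complete_uniform M ->
  (exists d, dense_seq d) -> analytic [set: M].
Proof.
move=> cM [d dd].
pose F : set (nat -> nat) := [set a | forall k, mdist (d (a k)) (d (a k.+1)) < 2 ^- k].
have /choice[f fP] : forall a, exists x, F a -> forall k, mdist (d (a k)) x <= 4 * 2 ^- k.
  move=> a; have [/(fast_cauchy_limit (u := d \o a) cM)[x xP]|nFa] := pselect (F a).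
    by exists x.
  by exists (d 0%N).
exists F, f; split.
- move=> a cla k; have [b Fb ab] := cla k.+2.
  by rewrite !ab.
- move=> a Fa U oU Ua.
  have : nbhs (f a) U by apply: open_nbhs_nbhs.
  rewrite -metricType_numDomainType.filter_from_mdist_nbhs => -[e /= e0 eU].
  (* Both limits are within [4 * 2 ^- k] of the common term [d (a k)]; agreement up to [k.+1] makes
     this term common. *)
  have [k ke] := @pow2V_lt R (e / 8) ltac:(by rewrite divr_gt0).
  exists k.+1 => b Fb ab; apply: eU.
  apply: le_lt_trans (metric_triangle _ (d (a k)) _) _.
  have := fP a Fa k; have := fP b Fb k; rewrite -ab// (metric_sym _ (f a)).
  by move: (mdist _ _) (mdist _ _) ke => p q; move: (2 ^- k) => r; lra.
- apply/seteqP; split=> x // _.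
  have /choice[a aP] : forall k, exists n, mdist x (d n) < 2 ^- k.+2.
    by move=> k; apply: dd; exact: pow2V_gt0.
  have Fa : F a.
    move=> k; apply: le_lt_trans (metric_triangle _ x _) _.
    rewrite (metric_sym (d (a k))); have := aP k; have := aP k.+1.
    have := @pow2VS R k; have := @pow2VS R k.+1; have := @pow2VS R k.+2.
    have := pow2V_gt0 R k.+3.
    move: (mdist _ _) (mdist _ _) => p q.
    move: (2 ^- k) (2 ^- k.+1) (2 ^- k.+2) (2 ^- k.+3) => r1 r2 r3 r4; lra.
  exists a => //; apply: (@mdist_small _ _ 8) => k.
  apply: le_trans (metric_triangle _ (d (a k)) _) _.
  have := fP a Fa k; have := aP k; have := @pow2VS R k; have := @pow2VS R k.+1.
  have := pow2V_gt0 R k.+2.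
  rewrite (metric_sym (f a)); rewrite (metric_sym x).
  move: (mdist _ _) (mdist _ _) (2 ^- k) (2 ^- k.+1) (2 ^- k.+2) => p q r1 r2 r3; lra.
Qed.

Lemma separating_seq (x0 : M) : separable M -> exists U : nat -> set M,
  (forall n, open (U n)) /\ forall x y, x <> y -> exists n, U n x /\ ~ U n y.
Proof.
move=> /(separable_dense_seq x0)[d dd].
pose U n := let: p := odflt (0%N, 0%N) (choice.unpickle n) in
  [set x | mdist (d p.1) x < 2 ^- p.2].
exists U; split.
  by move=> n; exact: open_mball.
move=> x y xy; have d0 : 0 < mdist x y by rewrite mdist_gt0; apply/eqP.
have [k ke] := @pow2V_lt R (mdist x y / 2) ltac:(by rewrite divr_gt0).
have [n nP] := dd x _ (pow2V_gt0 R k).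
exists (choice.pickle (n, k)); rewrite /U choice.pickleK /= metric_sym; split => // H.
have := metric_triangle x (d n) y.
by move: nP H ke; move: (mdist _ _) (mdist _ _) (mdist _ _) (2 ^- k) => p q r s; lra.
Qed.

End metric.

Section analytic_borel_sets.
Variables (T : topologicalType).
Hypothesis hT : hausdorff_space T.
Hypothesis aT : analytic [set: T].

Lemma analytic_closed (A : set T) : closed A -> analytic A.
Proof.
move=> cA; have [F [f [cl ct fT]]] := aT.
exists (F `&` f @^-1` A), f; split.
- move=> a cla; have Fa : F a.
    by apply: cl => n; have [b [Fb _] ab] := cla n; exists b.
  split => //; apply: contrapT => nA.
  have [n nP] := ct a Fa (~` A) (closed_openC cA) nA.
  by have [b [Fb Ab] ab] := cla n; apply: nP Ab.
- move=> a [Fa _] U oU Ua; have [n nP] := ct a Fa U oU Ua.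
  by exists n => b [Fb _]; exact: nP.
- apply/seteqP; split=> x /=; last by move=> [a [Fa Aa] <-].
  by move=> Ax; have : [set: T] x by []; rewrite fT => -[a Fa E]; exists a; rewrite //= E.
Qed.


Lemma analytic_sigma_algebra (t0 : T) :
  sigma_algebra [set: T] [set A | analytic A /\ analytic (~` A)].
Proof.
have a0 : analytic (set0 : set T) by apply: analytic_closed; exact: closed0.
split=> /= [|A [aA aC]|A aA].
- by rewrite setC0.
- by rewrite setTD setCK.
- split; first by apply: analytic_bigcup => // n; case: (aA n).
  by rewrite setC_bigcup; apply: analytic_bigcap => // n; case: (aA n).
Qed.

End analytic_borel_sets.

(** The sets that are analytic together with their complements form a sigma-algebra; it contains the
    open sets because these are countable unions of closed sets. *)
Lemma analytic_of_borel (R : realType) (M : metricType R) (x0 : M) (A : set M) :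
  analytic [set: M] -> borel M A -> analytic A.
Proof.
move=> aM bA; suff [] : [set A | analytic A /\ analytic (~` A)] A by [].
move: A bA; apply: smallest_sub.
  by apply: analytic_sigma_algebra => //; exact: metric_hausdorff.
move=> U oU; split; last by apply: analytic_closed => //; exact: open_closedC.
(* The points at distance at least [2 ^- n] from the complement of [U] form a closed set. *)
pose C n := [set x : M | forall y, mdist x y < 2 ^- n -> U y].
have -> : U = \bigcup_n C n.
  apply/seteqP; split=> x; last first.
    by move=> [n _]; apply; rewrite mdistxx pow2V_gt0.
  move=> Ux; have : nbhs x U by apply: open_nbhs_nbhs.
  rewrite -metricType_numDomainType.filter_from_mdist_nbhs => -[e /= e0 eU].
  have [n ne] := pow2V_lt e0; exists n => // y xy.
  by apply: eU; exact: lt_trans ne.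
apply: analytic_bigcup => n; apply: analytic_closed => //.
rewrite -openC (_ : ~` C n = \bigcup_(y in ~` U) [set x | mdist y x < 2 ^- n]).
  by apply: bigcup_open => y _; exact: open_mball.
apply/seteqP; split=> x /=.
  move=> /existsNP[y /not_implyP[xy nU]]; exists y => //=; by rewrite metric_sym.
by move=> [y /= nU yx] /(_ y); rewrite metric_sym => /(_ yx).
Qed.

Lemma polish_metric (R : realType) (T : topologicalType) : polish R T ->
  exists (M : metricType R) (f : T -> M) (g : M -> T),
    [/\ cancel f g, cancel g f, continuous f, continuous g &
      separable M /\ complete_uniform M].
Proof.
move=> [[D cD dD] [M [f [g [fK gK cf cg cM]]]]].
exists M, f, g; split => //; split => //; exists (f @` D).
  exact: sub_countable (card_image_le _ _) cD.
move=> O [x Ox] oO.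
have [|y [fOy Dy]] := dD (f @^-1` O) _ (open_comp (fun x _ => cf x) oO).
  by exists (g x); rewrite /preimage /= gK.
by exists (f y); split => //; exists y.
Qed.

Lemma standard_borel_metric (R : realType) (X : Type) (SX : set (set X)) :
  standard_borel R SX ->
  exists (M : metricType R) (h : X -> M) (g : M -> X),
    [/\ cancel h g, cancel g h, separable M, complete_uniform M &
      SX = [set h @^-1` B | B in borel M]].
Proof.
move=> [T [k [pT [k' kK k'K] ->]]].
have [M [f [g [fK gK cf cg [sM cM]]]]] := polish_metric pT.
exists M, (f \o k), (k' \o g); split => //.
- by move=> x /=; rewrite fK kK.
- by move=> x /=; rewrite k'K gK.
apply/seteqP; split=> A /= [B bB <-].
  exists (g @^-1` B); first exact: borel_preimage.
  by apply/seteqP; split=> x /=; rewrite fK.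
by exists (f @^-1` B); first exact: borel_preimage.
Qed.

Lemma standard_borel_sigma_algebra (R : realType) (X : Type) (SX : set (set X)) :
  standard_borel R SX -> sigma_algebra [set: X] SX.
Proof.
move=> /standard_borel_metric[M [h [g [_ _ _ _ ->]]]].
have sM := borel_sigma_algebra M; split.
- by exists set0; [case: sM|rewrite preimage_set0].
- move=> _ [B bB <-]; exists (~` B); last by rewrite setTD preimage_setC.
  by rewrite -setTD; case: sM => _ + _; exact.
- move=> A sA; have /choice[B BP] : forall n, exists B, borel M B /\ h @^-1` B = A n.
    by move=> n; have [B ? ?] := sA n; exists B.
  exists (\bigcup_n B n).
    by case: sM => _ _; apply=> n; case: (BP n).
  by rewrite preimage_bigcup; apply: eq_bigcupr => n _; case: (BP n).
Qed.

(** The Borel enumerations and colourings below use the topology only through such a family of Borel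
    sets. *)
Definition separating (X : Type) (U : nat -> set X) : Prop :=
  forall x y, x <> y -> exists n, U n x /\ ~ U n y.

Lemma polish_separating (R : realType) (T : topologicalType) (t0 : T) :
  polish R T -> exists2 U, separating U & forall n, borel T (U n).
Proof.
move=> /polish_metric[M [f [g [fK gK cf cg [sM _]]]]].
have [U [oU sU]] := separating_seq (f t0) sM.
exists (fun n => f @^-1` U n).
  move=> x y xy; apply: sU => E; apply: xy; exact: can_inj fK _ _ E.
by move=> n; apply: borel_preimage => //; exact: borel_open.
Qed.

Lemma standard_borel_separating (R : realType) (X : Type) (SX : set (set X)) (x0 : X) :
  standard_borel R SX -> exists2 U, separating U & forall n, SX (U n).
Proof.
move=> /standard_borel_metric[M [h [g [hK gK sM _ ->]]]].
have [U [oU sU]] := separating_seq (h x0) sM.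
exists (fun n => h @^-1` U n).
  move=> x y xy; apply: sU => E; apply: xy; exact: can_inj hK _ _ E.
by move=> n; exists (U n) => //; exact: borel_open.
Qed.

End complete_metric_spaces.

(** * Projections of Borel relations *)

Lemma continuous_fst (S T : topologicalType) : continuous (@fst S T).
Proof. by move=> [s t]; exact: cvg_fst. Qed.

Lemma continuous_snd (S T : topologicalType) : continuous (@snd S T).
Proof. by move=> [s t]; exact: cvg_snd. Qed.

Lemma hausdorff_setX (S T : topologicalType) :
  hausdorff_space S -> hausdorff_space T -> hausdorff_space (S * T)%type.
Proof.
move=> hS hT p q pq.
have -> : p = (p.1, p.2) by case: p {pq}.
have -> : q = (q.1, q.2) by case: q {pq}.
congr pair.
  apply: hS => A B pA qB.
  have [z [Az Bz]] := pq _ _ (continuous_fst pA) (continuous_fst qB).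
  by exists z.1.
apply: hT => A B pA qB.
have [z [Az Bz]] := pq _ _ (continuous_snd pA) (continuous_snd qB).
by exists z.2.
Qed.

Section projection.
Variables (R : realType) (M : metricType R) (X : Type) (SX : set (set X)).
Variables (h : X -> M) (g : M -> X) (x0 : M).
Hypotheses (hK : cancel h g) (gK : cancel g h).
Hypothesis aM : analytic [set: M].
Hypothesis SXE : SX = [set h @^-1` B | B in borel M].

Let hM : hausdorff_space M := @metric_hausdorff R M.

Lemma analytic_measurable A : SX A -> analytic (g @^-1` A).
Proof.
rewrite SXE => -[B bB <-].
rewrite (_ : _ @^-1` _ = B); first exact: analytic_of_borel.
by apply/seteqP; split=> x /=; rewrite gK.
Qed.

Lemma measurable_analytic A :
  analytic (g @^-1` A) -> analytic (g @^-1` (~` A)) -> SX A.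
Proof.
move=> aA aC; rewrite SXE; exists (g @^-1` A); first exact: analytic_borel.
by apply/seteqP; split=> x /=; rewrite hK.
Qed.

(** The same two-sided sigma-algebra argument, applied directly to the generating rectangles. *)
Lemma analytic_prod_algebra (H : set (X * X)) :
  sigma_algebra [set: X] SX -> prod_algebra SX SX H ->
  analytic [set p : M * M | H (g p.1, g p.2)].
Proof.
move=> sX pH; pose gg (p : M * M) := (g p.1, g p.2).
have hMM : hausdorff_space (M * M)%type by exact: hausdorff_setX.
have aMM : analytic [set: M * M] by rewrite -setXTT; exact: analytic_setX.
suff : [set H | analytic (gg @^-1` H) /\ analytic (gg @^-1` (~` H))] H by case.
move: H pH; apply: smallest_sub.
  have [s0 sC sU] := analytic_sigma_algebra hMM aMM (x0, x0); split.
  - split; first by rewrite preimage_set0; exact: s0.1.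
    by rewrite -preimage_setC preimage_set0; exact: s0.2.
  - by move=> A [aA aC]; rewrite setTD; split; rewrite ?setCK.
  - move=> A aA; rewrite /mkset -preimage_setC preimage_bigcup.
    by apply: sU => n; rewrite /mkset preimage_setC; exact: aA.
move=> _ [A sA [B sB <-]].
have sC C : SX C -> SX (~` C) by rewrite -setTD; case: sX => _ + _; exact.
split.
  rewrite (_ : gg @^-1` _ = (g @^-1` A) `*` (g @^-1` B))//.
  by apply: analytic_setX; exact: analytic_measurable.
rewrite (_ : gg @^-1` _ =
    ((g @^-1` (~` A)) `*` setT) `|` (setT `*` (g @^-1` (~` B)))).
  apply: analytic_setU; first exact: (x0, x0).
    by apply: analytic_setX => //; apply: analytic_measurable; exact: sC.
  by apply: analytic_setX => //; apply: analytic_measurable; exact: sC.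
apply/seteqP; split=> -[s t] /=.
  by move=> /not_andP[]; [left|right].
by move=> [[nA _] [? _]|[_ nB] [_ ?]]; [exact: nA|exact: nB].
Qed.

(** The set is the projection to the first factor of the part of [G] with second coordinate in
    [B]. *)
Lemma analytic_neighborhood (G : X -> X -> Prop) B :
  sigma_algebra [set: X] SX -> prod_algebra SX SX [set p | G p.1 p.2] ->
  SX B -> analytic (g @^-1` [set x | exists y, G x y /\ B y]).
Proof.
move=> sX pG sB.
have hMM : hausdorff_space (M * M)%type by exact: hausdorff_setX.
have := analytic_image (@continuous_fst M M)
  (analytic_setI hMM (analytic_prod_algebra sX pG)
    (analytic_setX aM (analytic_measurable sB))).
congr analytic; apply/seteqP; split=> s /=.
  by move=> [[s' t] /= [Gst [_ Bt]] <-]; exists (g t).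
move=> [y [Gy By]]; by exists (s, h y) => //=; split; rewrite /= ?hK.
Qed.

End projection.

(** * Borel enumeration of finite sections *)

Section separating_family.
Variables (Y : choiceType) (U : nat -> set Y).
Hypothesis sU : separating U.
Implicit Types (s : seq bool) (x y : Y).

Definition bitcode (m : nat) x : seq bool := mkseq (fun i => `[<U i x>]) m.

Definition cell s : set Y := [set y | bitcode (size s) y = s].

Lemma size_bitcode m x : size (bitcode m x) = m. Proof. exact: size_mkseq. Qed.

Lemma cell_bitcode m x : cell (bitcode m x) x.
Proof. by rewrite /cell /= size_bitcode. Qed.

Lemma bitcode_separates (F : seq Y) :
  exists m, {in F &, forall x y, bitcode m x = bitcode m y -> x = y}.
Proof.
have /choice[n nP] : forall p : Y * Y, exists n, p.1 <> p.2 -> U n p.1 /\ ~ U n p.2.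
  move=> [x y]; have [->|/sU[n]] := pselect (x = y); first by exists 0.
  by exists n.
pose m := \max_(p <- [seq (x, y) | x <- F, y <- F]) n p.
exists m.+1 => x y xF yF E.
apply: contrapT => xy; have [Ux Uy] := nP (x, y) xy.
have lt : n (x, y) < m.+1.
  by rewrite ltnS; apply: leq_bigmax_seq => //; apply: allpairs_f.
have := congr1 (fun s => nth false s (n (x, y))) E.
by rewrite !nth_mkseq// asboolT// asboolF.
Qed.

Lemma measurable_bitcode (SY : set (set Y)) : sigma_algebra [set: Y] SY ->
  (forall n, SY (U n)) -> forall m s, SY [set y | bitcode m y = s].
Proof.
move=> sY mU m s.
rewrite (_ : [set y | _] = [set y | m = size s /\
    forall i : 'I_m, U i y <-> nth false s i]).
  apply: sa_and => //; first exact: sa_const.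
  apply: sa_all => // i; apply: sa_and => //; apply: sa_imp => //;
    by [exact: sa_const|exact: mU].
apply/seteqP; split=> y /=.
  move=> <-; rewrite size_bitcode; split => // i.
  by rewrite nth_mkseq//; split=> /asboolP.
move=> [ms H]; apply: (@eq_from_nth _ false); rewrite size_bitcode// => i im.
rewrite nth_mkseq//; have := H (Ordinal im) => /= {}H.
by apply/asboolP/idP => /H.
Qed.

End separating_family.

Section finite_sections.
Variables (Y : choiceType) (U : nat -> set Y).
Hypothesis sU : separating U.

(** Distinct words of a common length have disjoint cells, whereas cells of different lengths may be
    nested. Counting thus becomes a countable disjunction of conditions that [V] meets a set. *)
Lemma card_geP (V : {fset Y}) (B : set Y) n :
  n <= #|` [fset y in V | `[<B y>]]%fset| <->
  exists t, [/\ size t = n, uniq t, exists m, forall s, s \in t -> size s = m &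
    forall s, s \in t -> exists y, y \in V /\ (cell U s `&` B) y].
Proof.
set W := [fset y in V | _]%fset.
have WP y : y \in W -> y \in V /\ B y by rewrite !inE => /andP[-> /asboolP].
split=> [nW|[t [<- ut [m tm] tV]]].
  have [m mP] := bitcode_separates sU W.
  exists (take n (map (bitcode U m) W)); split.
  - by rewrite size_takel// size_map.
  - by rewrite take_uniq// map_inj_in_uniq.
  - by exists m => _ /mem_take/mapP[y _ ->]; exact: size_bitcode.
  - move=> _ /mem_take/mapP[y /WP[yV By] ->]; exists y; split => //; split => //.
    exact: cell_bitcode.
have [->//|[s0 s0t]] : t = [::] \/ exists s0, s0 \in t.
  by case: (t) => [|s0 t']; [left|right; exists s0; rewrite inE eqxx].
have [y0 _] := tV _ s0t.
have /choice[f fP] : forall s, exists y, s \in t -> y \in V /\ (cell U s `&` B) y.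
  by move=> s; have [/tV[y yP]|nst] := boolP (s \in t); [exists y|exists y0].
rewrite -(size_map f); apply: uniq_leq_size.
  rewrite map_inj_in_uniq// => s1 s2 s1t s2t E.
  have [_ [c1 _]] := fP _ s1t; have [_ [c2 _]] := fP _ s2t.
  by move: c1 c2; rewrite /cell /= E !tm// => -> .
move=> _ /mapP[s /fP[fV [_ Bf]] ->].
by rewrite !inE fV; apply/asboolP.
Qed.

(* Expresses the absence of a point of B by the presence of many points outside
   B, which turns a coanalytic condition into an analytic one. *)
Lemma fset_avoidsP (V : {fset Y}) (B : set Y) :
  (forall y, y \in V -> ~ B y) <->
  exists t, [/\ size t = #|` V|, uniq t, exists m, forall s, s \in t -> size s = m &
    forall s, s \in t -> exists y, y \in V /\ (cell U s `&` ~` B) y].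
Proof.
rewrite -card_geP; set W := [fset y in V | _]%fset.
have WV : (W `<=` V)%fset by apply/fsubsetP => y; rewrite !inE => /andP[].
split=> [VB|cVW].
  apply: fsubset_leq_card; apply/fsubsetP => y yV; rewrite !inE yV.
  exact/asboolP/VB.
have /eqP WE : W == V by rewrite eqEfcard WV.
by move=> y; rewrite -WE !inE => /andP[_ /asboolP].
Qed.

Section enumeration.
Variables (X : Type) (SX : set (set X)) (SY : set (set Y)) (V : X -> {fset Y}).
Hypotheses (sX : sigma_algebra [set: X] SX) (sY : sigma_algebra [set: Y] SY).
Hypothesis mU : forall n, SY (U n).
Hypothesis mV : forall B, SY B -> SX [set x | exists y, y \in V x /\ B y].
Hypothesis V0 : forall x, exists y, y \in V x.

Let dec n : seq bool := odflt [::] (choice.unpickle n).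

(** The word coded by [n] isolates [y] in [V x]. Every point of the finite set [V x] is isolated by
    some word, so these indices enumerate it. *)
Let sel n x y : Prop := [/\ y \in V x, cell U (dec n) y &
  forall z, z \in V x -> cell U (dec n) z -> z = y].

Let mcell s : SY (cell U s). Proof. exact: measurable_bitcode. Qed.

Let mcellI s B : SY B -> SY (cell U s `&` B).
Proof. exact: (sa_and sY (mcell s)). Qed.

Let sel_exists x y : y \in V x -> exists n, sel n x y.
Proof.
move=> yV; have [m mP] := bitcode_separates sU (V x).
exists (choice.pickle (bitcode U m y)); rewrite /sel /dec choice.pickleK /=; split => //.
  exact: cell_bitcode.
by move=> z zV; rewrite /cell /= size_bitcode => /(mP z y zV yV).
Qed.

Let misolated n : SX [set x | exists y, sel n x y].
Proof.
have hit s1 : SX [set x | exists y, y \in V x /\ (cell U (dec n) `&` cell U s1) y].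
  by apply: mV; exact: mcellI.
(* A cell met by [V x] isolates a point exactly when no two distinct words of equal length are both
   met inside it. *)
rewrite (_ : [set x | _] = [set x | (exists y, y \in V x /\ cell U (dec n) y) /\
  forall s1 s2 : seq bool, (size s1 = size s2 /\ s1 <> s2) ->
    ~ ((exists y, y \in V x /\ (cell U (dec n) `&` cell U s1) y) /\
      (exists y, y \in V x /\ (cell U (dec n) `&` cell U s2) y))]).
  apply: sa_and => //; first exact/mV/mcell.
  apply: sa_all => // s1; apply: sa_all => // s2; apply: sa_imp => //.
    exact: sa_const.
  by apply: sa_not => //; apply: sa_and => //; exact: hit.
apply/seteqP; split=> x /=.
  move=> [y [yV cy uy]]; split; first by exists y.
  move=> s1 s2 [ss ns] [[y1 [y1V [c1 c1']]] [y2 [y2V [c2 c2']]]]; apply: ns.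
  by rewrite -c1' -c2' (uy _ y1V c1) (uy _ y2V c2) ss.
move=> [[y [yV cy]] H]; exists y; split => // z zV cz; apply: contrapT => zy.
have [m mP] := bitcode_separates sU (V x).
apply: (H (bitcode U m z) (bitcode U m y)).
  by rewrite !size_bitcode; split => // /(mP _ _ zV yV).
split; [exists z|exists y]; split => //; split => //; exact: cell_bitcode.
Qed.

Lemma measurable_card n : SX [set x | #|` V x| = n].
Proof.
have mge k : SX [set x | k <= #|` V x|].
  rewrite (_ : [set x | _] = [set x | exists t : seq (seq bool),
      (size t = k /\ uniq t /\ exists m, forall s, s \in t -> size s = m) /\
      forall s, s \in t -> exists y, y \in V x /\ cell U s y]).
    apply: sa_ex => // t; apply: sa_and => //; first exact: sa_const.
    by apply: sa_all_in => // s _; apply: mV; exact: mcell.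
  have VT x : [fset y in V x | `[<setT y>]]%fset = V x.
    by apply/fsetP => y; rewrite !inE asboolT ?andbT.
  apply/seteqP; split=> x /=; have := card_geP (V x) setT k; rewrite VT => gP.
    by move=> /gP[t [st ut mt tV]]; exists t; split => // s /tV[y [yV [cy _]]]; exists y.
  move=> [t [[st [ut mt]] tV]]; apply/gP; exists t; split => //.
  by move=> s /tV[y [yV cy]]; exists y.
rewrite (_ : [set x | _] = [set x | n <= #|` V x| /\ ~ n < #|` V x|]).
  by apply: sa_and => //; apply: sa_not.
apply/seteqP; split=> x /=; first by move=> ->; rewrite leqnn ltnn.
by move=> [h /negP]; rewrite -leqNgt => h'; apply/eqP; rewrite eqn_leq h h'.
Qed.

Lemma measurable_enumeration : exists l : nat -> X -> Y,
  (forall n, borel_fun SX SY (l n)) /\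
  forall x y, y \in V x <-> exists n, l n x = y.
Proof.
(* The first isolating index [j x] replaces each index that isolates nothing, so that every [l n] is
   total. *)
have [j jP] : exists j, forall x,
    (exists y, sel (j x) x y) /\ forall n, (exists y, sel n x y) -> j x <= n.
  apply: (least_exists (P := fun n x => exists y, sel n x y)) => x.
  by have [y /sel_exists[n ny]] := V0 x; exists n, y.
have mj := sa_minimal sX misolated jP.
have /choice[l lP] : forall p : nat * X, exists y,
    sel (if pselect (exists z, sel p.1 p.2 z) then p.1 else j p.2) p.2 y.
  by move=> [n x] /=; case: pselect => /= h //; case: (jP x).
exists (fun n x => l (n, x)); split=> [n B mB|x y].
  rewrite (_ : _ @^-1` _ = [set x |
      ((exists y, sel n x y) /\ exists y, y \in V x /\ (cell U (dec n) `&` B) y) \/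
      (~ (exists y, sel n x y) /\
        exists y, y \in V x /\ (cell U (dec (j x)) `&` B) y)]).
    apply: sa_or => //; apply: sa_and => //.
    - exact/mV/mcellI.
    - exact: sa_not.
    - apply: (sa_subst (P := fun i x =>
          exists y, y \in V x /\ (cell U (dec i) `&` B) y) sX mj).
      by move=> i; exact/mV/mcellI.
  apply/seteqP; split=> x /=; have := lP (n, x); case: pselect => /= h [lV cl ul].
  - by move=> Bl; left; split => //; exists (l (n, x)).
  - by move=> Bl; right; split => //; exists (l (n, x)).
  - by move=> [[_ [y [yV [cy By]]]]|[]//]; rewrite -(ul y).
  - by move=> [[]//|[_ [y [yV [cy By]]]]]; rewrite -(ul y).
split=> [yV|[n <-]]; last by have [] := lP (n, x).
have [n ny] := sel_exists yV; exists n; have := lP (n, x).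
case: pselect => /= [_ [lV cl _]|[]]; last by exists y.
by case: ny => _ _; apply.
Qed.

End enumeration.
End finite_sections.

Lemma measurable_list_hit (Y : choiceType) (SY : set (set Y)) (X : Type)
    (SX : set (set X)) (L : X -> {fset Y}) B :
  borel_fun SX (fset_algebra SY) L -> SY B ->
  SX [set x | exists y, y \in L x /\ B y].
Proof.
move=> mL sB; apply: (mL [set F | exists y, y \in F /\ B y]) => n.
have sT := @smallest_sigma_algebra _ [set: n.-tuple Y] (\bigcup_(i in [set: 'I_n])
  preimage_set_system [set: n.-tuple Y] (fun t => tnth t i) SY).
rewrite (_ : [set t | _] = [set t : n.-tuple Y | exists i, B (tnth t i)]).
  apply: (sa_ex sT) => i; apply: sub_gen_smallest; exists i => //.
  by exists B => //; rewrite setTI.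
apply/seteqP; split=> t /=.
  by move=> [y []]; rewrite inE => /tnthP[i ->] Bi; exists i.
move=> [i Bi]; exists (tnth t i); split => //.
by rewrite inE; apply: mem_tnth.
Qed.

(** * Borel neighbourhoods *)

Section neighborhoods.
Variables (R : realType) (X : choiceType) (SX : set (set X)) (G : X -> X -> Prop).
Hypothesis X_standard : standard_borel R SX.
Hypothesis G_borel : prod_algebra SX SX [set p | G p.1 p.2].
Hypothesis G_fin : locally_finite G.
Hypothesis G_degree : forall n, SX [set x | degree G x = n].

Theorem measurable_neighborhood B :
  SX B -> SX [set x | exists y, G x y /\ B y].
Proof.
move=> sB; have sX := standard_borel_sigma_algebra X_standard.
have [[x0 _]|noX] := pselect (exists x : X, True); last first.
  rewrite (_ : [set x | _] = set0); first by case: sX.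
  by apply/seteqP; split=> x //= _; case: noX; exists x.
have [U sU mU] := standard_borel_separating x0 X_standard.
have [M [h [g [hK gK sM cM SXE]]]] := standard_borel_metric X_standard.
have aM := analytic_complete cM (separable_dense_seq (h x0) sM).
apply: (measurable_analytic hK SXE).
  exact: (analytic_neighborhood (h x0) hK gK aM SXE).
pose V x := fset_set (neighbors G x).
have VG x y : y \in V x <-> G x y by rewrite in_fset_set// inE.
have -> : ~` [set x | exists y, G x y /\ B y] = [set x | exists t : seq (seq bool),
    (size t = degree G x /\ uniq t /\ exists m, forall s, s \in t -> size s = m) /\
    forall s, s \in t -> exists y, G x y /\ (cell U s `&` ~` B) y].
  apply/seteqP; split=> x /=.
    move=> nB; have /(fset_avoidsP sU)[t [st ut mt tV]] : forall y, y \in V x -> ~ B y.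
      by move=> y /VG Gxy By; apply: nB; exists y.
    by exists t; split => // s /tV[y [/VG ? ?]]; exists y.
  move=> [t [[st [ut mt]] tV]] [y [/VG yV By]].
  suff : forall y, y \in V x -> ~ B y by move=> /(_ y yV).
  apply/(fset_avoidsP sU); exists t; split=> // s /tV[z [/VG ? ?]]; by exists z.
apply: (analytic_ex (h x0)) => t; apply: analytic_setI; first exact: metric_hausdorff.
  apply: (analytic_measurable (h x0) gK aM SXE (A := [set x | size t = degree G x /\
    (uniq t /\ exists m, forall s, s \in t -> size s = m)])).
  apply: sa_and => //; last exact: sa_const.
  rewrite (_ : [set x | _] = [set x | degree G x = size t])//.
  by apply/seteqP; split=> x /= ->.
apply: analytic_all_in => //; first exact: metric_hausdorff.
move=> s; apply: (analytic_neighborhood (h x0) hK gK aM SXE) => //.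
apply: sa_and; [by []|exact: measurable_bitcode|].
exact: sa_not.
Qed.

End neighborhoods.

(** * Borel colourings of locally finite graphs *)

Lemma measurable_eq (X : Type) (Y : choiceType) (SX : set (set X)) (SY : set (set Y))
    (U : nat -> set Y) (f f' : X -> Y) :
  sigma_algebra [set: X] SX -> separating U -> (forall n, SY (U n)) ->
  borel_fun SX SY f -> borel_fun SX SY f' -> SX [set x | f x = f' x].
Proof.
move=> sX sU mU mf mf'.
rewrite (_ : [set x | _] = [set x | forall n,
    (U n (f x) -> U n (f' x)) /\ (U n (f' x) -> U n (f x))]).
  apply: sa_all => // n; have m1 := mf _ (mU n); have m2 := mf' _ (mU n).
  by apply: sa_and => //; apply: sa_imp.
apply/seteqP; split=> x /= => [->//|H].
by apply: contrapT => /sU[n [Un nU]]; apply: nU; apply: (H n).1.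
Qed.

Lemma measurable_prod_algebra (X Y Z : Type) (SX : set (set X)) (SY : set (set Y))
    (SZ : set (set Z)) (H : set (Y * Z)) (f : X -> Y) (f' : X -> Z) :
  sigma_algebra [set: X] SX ->
  prod_algebra SY SZ H -> borel_fun SX SY f -> borel_fun SX SZ f' ->
  SX [set x | H (f x, f' x)].
Proof.
move=> sX + mf mf'; move: H.
apply: (smallest_sub (X := [set H : set (Y * Z) | SX [set x | H (f x, f' x)]])).
  split=> /=.
  - exact: sa_const.
  - move=> A mA; rewrite (_ : [set x | _] = [set x | ~ A (f x, f' x)]).
      exact: sa_not.
    by apply/seteqP; split=> x /=; [case|split].
  - move=> A mA; rewrite (_ : [set x | _] = [set x | exists n, A n (f x, f' x)]).
      exact: sa_ex_nat.
    by apply/seteqP; split=> x /= [n]; exists n.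
move=> _ [A mA [B mB <-]].
exact: (sa_and sX (mf _ mA) (mf' _ mB)).
Qed.

Definition lex3 (p q : nat * nat * nat) : Prop :=
  p.1.1 < q.1.1 \/ p.1.1 = q.1.1 /\
  (p.1.2 < q.1.2 \/ p.1.2 = q.1.2 /\ p.2 < q.2).

Lemma lex3_total p q : p <> q -> lex3 p q \/ lex3 q p.
Proof.
case: p q => [[a b] c] [[a' b'] c'] pq; rewrite /lex3 /=.
have : ~ (a = a' /\ b = b' /\ c = c').
  by move=> [aE [bE cE]]; apply: pq; rewrite aE bE cE.
lia.
Qed.

Lemma lex3_ind (P : nat * nat * nat -> Prop) :
  (forall p, (forall q, lex3 q p -> P q) -> P p) -> forall p, P p.
Proof.
move=> H [[a b] c]; elim/ltn_ind: a b c => a IHa; elim/ltn_ind => b IHb.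
elim/ltn_ind => c IHc; apply: H => -[[a' b'] c'].
by rewrite /lex3 /= => -[/IHa//|[->]] [/IHb//|[->]] /IHc.
Qed.

(** Choosability is expressed through an adjacency table. There are finitely many tables for each
    [n], so the condition is Borel on pieces although it quantifies over all lists in [Y]. *)
Definition choosable_adjacency (Y : choiceType) n
    (e : {ffun 'I_n * 'I_n -> bool}) : Prop :=
  forall M : 'I_n -> {fset Y}, (forall i, #|[pred j | e (i, j)]| <= #|` M i|) ->
  exists v : 'I_n -> Y, (forall i, v i \in M i) /\
    forall i j, e (i, j) -> v i <> v j.

Section borel_graph.
Variables (X : choiceType) (SX : set (set X)) (G : X -> X -> Prop).
Variables (U : nat -> set X) (gs : nat -> X -> X).
Hypothesis sX : sigma_algebra [set: X] SX.
Hypothesis graphG : is_graph G.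
Hypothesis finG : locally_finite G.
Hypothesis mG : forall f f' : X -> X,
  borel_fun SX SX f -> borel_fun SX SX f' -> SX [set x | G (f x) (f' x)].
Hypothesis sU : separating U.
Hypothesis mU : forall n, SX (U n).
Hypothesis mgs : forall i, borel_fun SX SX (gs i).
Hypothesis gsP : forall x y, x = y \/ G x y <-> exists i, gs i x = y.

Definition act (w : seq nat) (x : X) : X := foldl (fun y i => gs i y) x w.

Lemma act_cat w w' x : act (w ++ w') x = act w' (act w x).
Proof. exact: foldl_cat. Qed.

Lemma act_rcons w i x : act (rcons w i) x = gs i (act w x).
Proof. exact: foldl_rcons. Qed.

Lemma borel_comp (Z : Type) (SZ : set (set Z)) (f : X -> X) (k : X -> Z) :
  borel_fun SX SX f -> borel_fun SX SZ k -> borel_fun SX SZ (k \o f).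
Proof. by move=> mf mk B /mk /mf. Qed.

Lemma measurable_comp (P : set X) (f : X -> X) :
  borel_fun SX SX f -> SX P -> SX [set x | P (f x)].
Proof. by move=> mf /mf. Qed.

Lemma measurable_act w : borel_fun SX SX (act w).
Proof.
elim/last_ind: w => [|w i IHw]; first by move=> B.
rewrite (_ : act (rcons w i) = gs i \o act w); last exact/funext/act_rcons.
exact: borel_comp.
Qed.

Lemma borel_id : borel_fun SX SX id. Proof. by []. Qed.

Lemma measurable_ex_nbr (P : X -> X -> Prop) :
  (forall i, SX [set x | P x (gs i x)]) -> SX [set x | exists y, G x y /\ P x y].
Proof.
move=> mP; rewrite (_ : [set x | _] = [set x | exists i, G x (gs i x) /\ P x (gs i x)]).
  by apply: sa_ex => // i; apply: sa_and => //; exact: mG.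
apply/seteqP; split=> x /= => [[y [xy Pxy]]|[i [? ?]]]; last by exists (gs i x).
by have [i iy] := (gsP x y).1 (or_intror xy); exists i; rewrite iy.
Qed.

Lemma measurable_all_nbr (P : X -> X -> Prop) :
  (forall i, SX [set x | P x (gs i x)]) -> SX [set x | forall y, G x y -> P x y].
Proof.
move=> mP; apply: sa_notE => //.
rewrite (_ : [set x | _] = [set x | exists y, G x y /\ ~ P x y]).
  by apply: measurable_ex_nbr => i; apply: sa_not.
apply/seteqP; split=> x /=; last by move=> [y [xy nP]] /(_ y xy).
by move=> /existsNP[y /not_implyP[? ?]]; exists y.
Qed.

Lemma componentP x y : component G x y <-> exists w, act w x = y.
Proof.
split=> [|[w <-]].
  move=> /clos_rt_rtn1_iff; elim=> [|z t zt _ [w wz]]; first by exists [::].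
  have [i it] := (gsP z t).1 (or_intror zt).
  by exists (rcons w i); rewrite act_rcons wz.
elim/last_ind: w => [|w i IHw]; first exact: rt_refl.
rewrite act_rcons; have := (gsP (act w x) (gs i (act w x))).2 (ex_intro _ i erefl).
by case=> [<-//|h]; exact: rt_trans IHw (rt_step _ _ _ _ h).
Qed.

Lemma component_sym x y : component G x y -> component G y x.
Proof.
elim=> [a b ab|a|a b c _ ab _ bc]; first by apply: rt_step; exact: graphG.1.
  exact: rt_refl.
exact: rt_trans bc ab.
Qed.

Lemma measurable_ex_component (P : X -> X -> Prop) :
  (forall w, SX [set x | P x (act w x)]) ->
  SX [set x | exists y, component G x y /\ P x y].
Proof.
move=> mP; rewrite (_ : [set x | _] = [set x | exists w, P x (act w x)]).
  exact: sa_ex.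
apply/seteqP; split=> x /= => [[y [/componentP[w <-] ?]]|[w ?]]; first by exists w.
by exists (act w x); split => //; apply/componentP; exists w.
Qed.

Lemma measurable_all_component (P : X -> X -> Prop) :
  (forall w, SX [set x | P x (act w x)]) ->
  SX [set x | forall y, component G x y -> P x y].
Proof.
move=> mP; rewrite (_ : [set x | _] = [set x | forall w, P x (act w x)]).
  exact: sa_all.
apply/seteqP; split=> x /= H; last by move=> y /componentP[w <-].
by move=> w; apply: H; apply/componentP; exists w.
Qed.

(** Words of length exactly [r] reach the whole ball, because the maps [gs i] enumerate closed
    neighbourhoods and a word may stand still. *)
Definition in_ball r x y : Prop := exists w, size w = r /\ act w x = y.

Lemma in_ball0 x : in_ball 0 x x. Proof. by exists [::]. Qed.

Lemma in_ball1 x y : x = y \/ G x y <-> in_ball 1 x y.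
Proof.
rewrite gsP; split=> [[i <-]|[w [w1 <-]]]; first by exists [:: i].
by case: w w1 => [|i [|]]// _; exists i.
Qed.

Lemma in_ball_trans r r' x y z :
  in_ball r x y -> in_ball r' y z -> in_ball (r + r') x z.
Proof.
move=> [w [<- <-]] [w' [<- <-]]; exists (w ++ w').
by rewrite size_cat act_cat.
Qed.

Lemma in_ball_le r r' x y : r <= r' -> in_ball r x y -> in_ball r' x y.
Proof.
move=> /subnKC <-; elim: (r' - r) => [|n IHn]; first by rewrite addn0.
move=> /IHn H; rewrite addnS -addn1; apply: in_ball_trans H _.
by apply/in_ball1; left.
Qed.

Lemma in_ball_sym r x y : in_ball r x y -> in_ball r y x.
Proof.
move=> [w []]; elim/last_ind: w r y => [|w i IHw] r y.
  by move=> <- <-; exact: in_ball0.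
rewrite size_rcons act_rcons => <- wy; rewrite -add1n.
apply: in_ball_trans (IHw _ _ erefl erefl).
have : in_ball 1 (act w x) y by exists [:: i].
by move=> /in_ball1[->|h]; apply/in_ball1; [left|right; exact: graphG.1].
Qed.

Lemma in_ball_component r x y : in_ball r x y -> component G x y.
Proof. by move=> [w [_ <-]]; apply/componentP; exists w. Qed.

Lemma ball_finite r x : exists F : seq X, forall y, in_ball r x y -> y \in F.
Proof.
elim: r => [|r [F FP]].
  by exists [:: x] => y [w [/size0nil -> <-]]; rewrite inE.
exists (F ++ flatten [seq enum_fset (fset_set (neighbors G z)) | z <- F]) => y.
move=> [w []]; case/lastP: w => // w i; rewrite size_rcons act_rcons => -[wr wy].
have zF : act w x \in F by apply: FP; exists w.
rewrite mem_cat; have [<-|zy] := (gsP (act w x) y).2 (ex_intro _ i wy).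
  by rewrite zF.
apply/orP; right; apply/flattenP; exists (enum_fset (fset_set (neighbors G (act w x)))).
  by apply/mapP; exists (act w x).
by rewrite -[_ \in _]/(y \in fset_set _) in_fset_set// inE.
Qed.

(* The colour of x consists of its first bits that determine it in its ball. *)
Lemma distance_coloring r : exists k : X -> seq bool,
  (forall s, SX [set x | k x = s]) /\
  forall x y, in_ball r x y -> k x = k y -> x = y.
Proof.
pose P m x := forall w, size w = r ->
  bitcode U m (act w x) = bitcode U m x -> act w x = x.
have [m mP] : exists m, forall x, P (m x) x /\ forall n, P n x -> m x <= n.
  apply: least_exists => x; have [F FP] := ball_finite r x.
  have [m mF] := bitcode_separates sU (x :: F); exists m => w wr.
  apply: mF; rewrite inE ?eqxx//; apply/orP; right; apply: FP.
  by exists w.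
have mbit n w s : SX [set x | bitcode U n (act w x) = s].
  exact: (measurable_act w (measurable_bitcode sX mU n s)).
have mP' n : SX [set x | P n x].
  apply: sa_all => // w; apply: sa_imp => //; first exact: sa_const.
  apply: sa_imp => //; last exact: (measurable_eq sX sU mU (measurable_act w) borel_id).
  rewrite (_ : [set x | _] = [set x | exists s,
      bitcode U n (act w x) = s /\ bitcode U n (act [::] x) = s]).
    by apply: sa_ex => // s; apply: sa_and.
  by apply/seteqP; split=> x /= => [->|[s [-> <-]]//]; exists (bitcode U n x).
exists (fun x => bitcode U (m x) x); split=> [s|x y [w [wr <-]] E].
  apply: (sa_subst (P := fun n x => bitcode U n x = s) sX (sa_minimal sX mP' mP)) => n.
  exact: (mbit n [::]).
(* Equal codes have equal length, so both points use the same number of bits. *)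
have mE : m x = m (act w x) by rewrite -[LHS](size_bitcode U _ x) E size_bitcode.
by apply/esym; apply: (mP x).1 => //; rewrite E mE.
Qed.

(** * Finite ranks of relations contained in the graph *)

Section exhaustion.
Variable r : X -> X -> Prop.
Hypothesis rG : forall x y, r x y -> G x y.

(** All [r]-paths from [x] have fewer than [n] edges. This serves both for the distance to [A] and
    for the order of the greedy colouring. *)
Fixpoint exhausted n (x : X) {struct n} : Prop :=
  if n is m.+1 then forall y, r x y -> exhausted m y else False.

Lemma exhausted_le m n x : m <= n -> exhausted m x -> exhausted n x.
Proof.
elim: m n x => // m IHm [//|n] x; rewrite ltnS => mn H y xy.
by apply: IHm mn _; exact: H.
Qed.

(** König's lemma in terms of ranks: finitely many successors have a common bound. *)
Lemma exhausted_succ x : (forall y, r x y -> exists n, exhausted n y) ->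
  exists n, exhausted n x.
Proof.
move=> exr; pose F := enum_fset (fset_set (neighbors G x)).
have FP y : r x y -> y \in F.
  by move=> /rG xy; rewrite -[_ \in _]/(y \in fset_set _) in_fset_set// inE.
have /choice[f fP] : forall y, exists n, r x y -> exhausted n y.
  by move=> y; have [/exr[n rn]|nxy] := pselect (r x y); [exists n|exists 0].
exists (\max_(y <- F) f y).+1 => y xy; apply: exhausted_le (fP y xy).
by apply: leq_bigmax_seq => //; exact: FP.
Qed.

Lemma measurable_exhausted n : (forall i, SX [set x | r x (gs i x)]) ->
  SX [set x | exhausted n x].
Proof.
move=> mr; elim: n => [|n IHn]; first exact: sa_const.
rewrite (_ : [set x | _] = [set x | forall y, G x y -> r x y -> exhausted n y]).
  apply: (measurable_all_nbr) => i; apply: sa_imp => //.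
  exact: (measurable_comp (mgs i) IHn).
by apply/seteqP; split=> x /= H y => [_ /H//|xy]; apply: H => //; exact: rG.
Qed.

End exhaustion.

Section ordering.
Variable A : set X.
Hypothesis mA : SX A.
Hypothesis meetA : forall x, exists w, A (act w x).

(* Points all of whose neighbours further away from A are exhausted after
   finitely many steps come first, by rank; the others, each of which has such a
   neighbour further away, come next, by distance. Ties are broken by a
   countable colouring. *)
Lemma coloring_order : exists key : X -> nat * nat * nat,
  [/\ forall p, SX [set x | key x = p],
      forall x y, G x y -> key x <> key y &
      forall x, ~ A x -> exists y, G x y /\ (A y \/ ~ lex3 (key y) (key x))].
Proof.
pose near n x := exists w, size w = n /\ A (act w x).
have mnear n : SX [set x | near n x].
  apply: sa_ex => // w; apply: sa_and => //; first exact: sa_const.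
  exact: (measurable_comp (measurable_act w) mA).
have [d dP] : exists d, forall x, near (d x) x /\ forall n, near n x -> d x <= n.
  by apply: least_exists => x; have [w Aw] := meetA x; exists (size w), w.
have md := sa_minimal sX mnear dP.
pose farther x y := G x y /\ d x < d y.
pose D := exhausted farther.
have fG x y : farther x y -> G x y by case.
have mD n : SX [set x | D n x].
  apply: measurable_exhausted => // i; apply: sa_and => //; first exact: mG.
  rewrite (_ : [set x | _] =
      [set x | exists m, d x = m /\ exists k, d (gs i x) = k /\ m < k]).
    apply: sa_ex => // m; apply: sa_and => //; apply: sa_ex => // k.
    apply: sa_and => //; last exact: sa_const.
    exact: (measurable_comp (mgs i) (md k)).
  apply/seteqP; split=> x /= => [?|[m [-> [k [->]]]]//].
  by exists (d x); split => //; exists (d (gs i x)).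
pose fin x := exists n, D n x.
have mfin : SX [set x | fin x] by exact: sa_ex.
have [rk rkP] : exists rk, forall x, (D (rk x) x \/ ~ fin x) /\
    forall n, D n x \/ ~ fin x -> rk x <= n.
  apply: least_exists => x; have [[n Dn]|nf] := pselect (fin x).
    by exists n; left.
  by exists 0; right.
have mrk : forall n, SX [set x | rk x = n].
  apply: (sa_minimal sX (P := fun n x => D n x \/ ~ fin x)) => // n.
  by apply: sa_or => //; exact: sa_not.
have [k [mk kP]] := distance_coloring 1.
pose key x := if pselect (fin x) then (0, rk x, choice.pickle (k x))
  else (1, d x, choice.pickle (k x)).
exists key; split.
- move=> [[a b] c]; rewrite (_ : [set x | _] = [set x |
      (exists s, k x = s /\ choice.pickle s = c) /\
      ((fin x /\ (0 = a /\ rk x = b)) \/ (~ fin x /\ (1 = a /\ d x = b)))]).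
    apply: sa_and => //.
      by apply: sa_ex => // s; apply: sa_and => //; exact: sa_const.
    apply: sa_or => //; apply: sa_and => //.
      by apply: sa_and => //; exact: sa_const.
      exact: sa_not.
    by apply: sa_and => //; exact: sa_const.
  apply/seteqP; split=> x /=; rewrite /key; case: pselect => fx.
  - by move=> [<- <- <-]; split; [exists (k x)|left].
  - by move=> [<- <- <-]; split; [exists (k x)|right].
  - by move=> [[s [-> ->]] [[_ [-> ->]]|[]//]].
  - by move=> [[s [-> ->]] [[]//|[_ [-> ->]]]].
- move=> x y xy kxy; have pk : choice.pickle (k x) = choice.pickle (k y).
    have : (key x).2 = (key y).2 by rewrite kxy.
    by rewrite /key; case: pselect; case: pselect.
  have kE : k x = k y by apply: (pcan_inj choice.pickleK).
  have xy1 : in_ball 1 x y by apply/(in_ball1); right.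
  by have E := kP x y xy1 kE; apply: (graphG.2 x); rewrite {2}E.
- move=> x nAx; have [fx|nfx] := pselect (fin x).
    (* A neighbour one step closer to [A] has [x] as a farther neighbour. It is therefore of
       infinite rank or of larger rank than [x], and comes later. *)
    have [[|i w] [sw Aw]] := (dP x).1; first by [].
    have dy : d (gs i x) < d x.
      by rewrite -sw /= ltnS; apply: (dP (gs i x)).2; exists w.
    have xy : G x (gs i x).
      have [E|//] := (gsP x (gs i x)).2 (ex_intro _ i erefl).
      by move: dy; rewrite -E ltnn.
    exists (gs i x); split => //; right.
    rewrite /lex3 /key; case: (pselect (fin x)) => // ?.
    case: (pselect (fin (gs i x))) => [fy|nfy] /=; last by lia.
    suff : rk x < rk (gs i x) by lia.
    have [Dy|] := (rkP (gs i x)).1; last by [].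
    case: (rk (gs i x)) Dy => // m H.
    by rewrite ltnS; apply: (rkP x).2; left; apply: H; split => //; exact: graphG.1.
  (* If all farther neighbours had finite rank, so would [x]. One without finite rank comes later by
     its distance. *)
  have [y [[xy dxy] nfy]] : exists y, farther x y /\ ~ fin y.
    apply: contrapT => no; apply: nfx; apply: exhausted_succ => // y xy.
    by apply: contrapT => nfy; apply: no; exists y.
  exists y; split => //; right.
  rewrite /lex3 /key; case: (pselect (fin x)) => // ?.
  by case: (pselect (fin y)) => //= ?; lia.
Qed.

End ordering.

(** * Greedy colouring outside [A] *)

Section greedy.
Variables (A : set X) (key : X -> nat * nat * nat).
Hypothesis mA : SX A.
Hypothesis mkey : forall p, SX [set x | key x = p].
Hypothesis key_edge : forall x y, G x y -> key x <> key y.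
Hypothesis later : forall x, ~ A x ->
  exists y, G x y /\ (A y \/ ~ lex3 (key y) (key x)).
Variables (Y : choiceType) (SY : set (set Y)) (UY : nat -> set Y).
Hypotheses (sUY : separating UY) (mUY : forall n, SY (UY n)).
Variables (L : X -> {fset Y}) (l : nat -> X -> Y).
Hypothesis cardL : forall x, #|` L x| = degree G x.
Hypothesis ml : forall n, borel_fun SX SY (l n).
Hypothesis lP : forall x y, y \in L x <-> exists n, l n x = y.

Let prec x y : Prop := [/\ G x y, ~ A y & lex3 (key y) (key x)].

Let mprec i : SX [set x | prec x (gs i x)].
Proof.
rewrite (_ : [set x | _] = [set x | G x (gs i x) /\ (~ A (gs i x) /\
    exists p q, key (gs i x) = p /\ key x = q /\ lex3 p q)]).
  apply: sa_and => //; first by apply: mG => //.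
  apply: sa_and => //.
    by apply: sa_not => //; exact: (measurable_comp (mgs i) mA).
  apply: sa_ex => // p; apply: sa_ex => // q; apply: sa_and => //.
    exact: (measurable_comp (mgs i) (mkey p)).
  by apply: sa_and => //; exact: sa_const.
apply/seteqP; split=> x /=.
  by move=> [? ? ?]; split => //; split => //; exists (key (gs i x)), (key x).
by move=> [? [? [p [q [<- [<- ?]]]]]].
Qed.

Let avoid (c : X -> nat) j x : Prop :=
  A x \/ forall y, prec x y -> l j x <> l (c y) y.

Let avoid_exists c x : exists j, avoid c j x.
Proof.
have [Ax|nAx] := pselect (A x); first by exists 0; left.
pose D := fset_set [set y | prec x y].
have fD : finite_set [set y | prec x y].
  by apply: sub_finite_set (finG x) => y [].
(* The neighbour given by [later] does not precede [x], so it is missing from [D]. *)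
have DL : #|` D| < #|` L x|.
  have [z [xz zA]] := later nAx.
  rewrite cardL /degree (cardfsD1 z (fset_set (neighbors G x))).
  rewrite in_fset_set// mem_set//= add1n ltnS.
  apply: fsubset_leq_card; apply/fsubsetP => y.
  rewrite in_fset_set// inE => -[xy nAy ky].
  rewrite !inE in_fset_set// mem_set// andbT; apply/eqP => E.
  by rewrite -E in zA; case: zA.
have [a /lP[j <-] av] := exists_avoiding (fun y => l (c y) y) DL.
exists j; right => y xy; apply/nesym/av.
by rewrite in_fset_set// mem_set.
Qed.

(** One round recolours all points simultaneously, each by the least index avoiding the current
    colours of its predecessors. Rounds are numbered by [nat] although the keys have a longer order
    type; each point stabilises after finitely many of them. *)
Let step c : {c' | forall x, avoid c (c' x) x /\ forall j, avoid c j x -> c' x <= j}.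
Proof. exact/cid/least_exists/avoid_exists. Qed.

Let col n : X -> nat := iter n (fun c => sval (step c)) (fun=> 0).

Let colS n x : avoid (col n) (col n.+1 x) x /\
  forall j, avoid (col n) j x -> col n.+1 x <= j.
Proof. exact: (svalP (step (col n))). Qed.

Let mcol n : forall j, SX [set x | col n x = j].
Proof.
elim: n => [|n IHn]; first by move=> j; exact: (sa_const sX (0 = j)).
apply: (sa_minimal sX (P := avoid (col n)) _ (colS n)) => j.
apply: sa_or => //.
rewrite (_ : [set x | _] =
    [set x | forall y, G x y -> prec x y -> l j x <> l (col n y) y]).
  apply: (measurable_all_nbr) => i; apply: sa_imp => //.
  have mcgs m : SX [set x | col n (gs i x) = m].
    exact: (measurable_comp (mgs i) (IHn m)).
  apply: (sa_subst (P := fun m x => l j x <> l m (gs i x)) sX mcgs) => m.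
  apply: sa_not => //; apply: (measurable_eq sX sUY mUY (ml j)).
  exact: borel_comp (mgs i) (ml m).
by apply/seteqP; split=> x /= H y => [_ /H//|xy]; apply: H => //; case: xy.
Qed.

Let settled := exhausted prec.

Let settled_exists x : exists n, settled n x.
Proof.
move E: (key x) => p; elim/lex3_ind: p x E => p IH x E.
apply: exhausted_succ => [y z []//|y xy]; apply: (IH (key y)) => //.
by rewrite -E; case: xy.
Qed.

Let col_stable n m x : n <= m -> settled n x -> col m x = col n x.
Proof.
elim: n m x => // n IHn [//|m] x; rewrite ltnS => nm dx.
have E y : prec x y -> col m y = col n y by move=> /dx; exact: IHn.
have avE j : avoid (col m) j x <-> avoid (col n) j x.
  by split=> -[|H]; [left|right=> y xy; rewrite -E//; exact: H|left|
    right=> y xy; rewrite E//; exact: H].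
apply/eqP; rewrite eqn_leq; apply/andP; split; apply: (colS _ _).2; apply/avE.
  exact: (colS n x).1.
exact: (colS m x).1.
Qed.

Lemma greedy_coloring : exists k : X -> nat,
  (forall n, SX [set x | k x = n]) /\
  forall x y, ~ A x -> ~ A y -> G x y -> l (k x) x <> l (k y) y.
Proof.
have [t tP] := least_exists settled_exists.
have mt : forall n, SX [set x | t x = n].
  apply: (sa_minimal sX (P := settled)) tP => n.
  by apply: measurable_exhausted => // x y [].
exists (fun x => col (t x) x); split=> [n|].
  apply: (sa_subst (P := fun m x => col m x = n) sX mt) => m; exact: mcol.
have main x y : ~ A x -> ~ A y -> G x y -> lex3 (key y) (key x) ->
    l (col (t x) x) x <> l (col (t y) y) y.
  move=> nAx nAy xy yx; pose n := maxn (t x) (t y).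
  (* Both points are settled after [n] rounds, and round [n.+1] chose the colour of [x] against the
     colour of [y] in round [n]. *)
  rewrite -(@col_stable (t x) n.+1 x) ?(leqW (leq_maxl _ _))//; last by case: (tP x).
  rewrite -(@col_stable (t y) n y) ?leq_maxr//; last by case: (tP y).
  by have [[//|H] _] := colS n x; apply: H.
move=> x y nAx nAy xy; have [yx|xy'] := lex3_total (nesym (key_edge xy)).
  exact: main.
by apply/nesym/main => //; exact: graphG.1.
Qed.

End greedy.

(** * Scattered pieces and the final colouring *)

Section pieces.
Variable Y : choiceType.
Implicit Type W : seq (seq nat).

(** A shape [W] applied to a base point [x] lists the points of a finite set; countably many shapes
    give all finite subsets of the component of [x]. *)
Definition pt W x i : X := act (nth [::] W i) x.

Lemma measurable_pt W i : borel_fun SX SX (fun x => pt W x i).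
Proof. exact: (measurable_act). Qed.

Definition pt_adjacency W x : {ffun 'I_(size W) * 'I_(size W) -> bool} :=
  [ffun p : 'I_(size W) * 'I_(size W) => `[<G (pt W x p.1) (pt W x p.2)>]].

Definition good_piece W x : Prop :=
  [/\ 0 < size W, forall i j : 'I_(size W), pt W x i = pt W x j -> i = j &
    choosable_adjacency Y (pt_adjacency W x)].

Lemma measurable_good_piece W : SX [set x | good_piece W x].
Proof.
rewrite (_ : [set x | _] = [set x | 0 < size W /\
  ((forall i j : 'I_(size W), pt W x i = pt W x j -> i = j) /\
    choosable_adjacency Y (pt_adjacency W x))]); last first.
  by apply/seteqP; split=> x /= => [[]|[? []]].
apply: sa_and => //; first exact: sa_const.
apply: sa_and => //.
  apply: sa_all => // i; apply: sa_all => // j; apply: sa_imp => //; last exact: sa_const.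
  exact: (measurable_eq sX sU mU (measurable_pt W i) (measurable_pt W j)).
apply: (sa_countable sX) => e.
rewrite (_ : [set x | _] = [set x | forall p : 'I_(size W) * 'I_(size W),
    (G (pt W x p.1) (pt W x p.2) -> e p) /\ (e p -> G (pt W x p.1) (pt W x p.2))]).
  apply: sa_all => // p; have mGp := mG (measurable_pt W p.1) (measurable_pt W p.2).
  by apply: sa_and => //; apply: sa_imp => //; exact: sa_const.
apply/seteqP; split=> x /= => [|H].
  by move=> <- p; rewrite ffunE; split=> /asboolP.
by apply/ffunP => p; rewrite ffunE; apply/asboolP/idP => /H.
Qed.

Lemma choosable_good_piece (y0 : Y) (S : {fset X}) x : [set` S] `<=` component G x ->
  degree_choosable Y G S -> exists W, good_piece W x.
Proof.
move=> SC [[s0 s0S] SM].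
have /choice[w wP] : forall y, exists w, y \in S -> act w x = y.
  move=> y; have [/SC/componentP[w wy]|nyS] := boolP (y \in S); first by exists w.
  by exists [::].
pose W := map w S; exists W.
have sW : size W = #|` S| by rewrite size_map.
have ptS i : i < size W -> pt W x i = nth x S i.
  move=> iW; rewrite /pt (nth_map x) -?sW// wP//.
  by apply: mem_nth; rewrite -sW.
have inS i : i < size W -> pt W x i \in S.
  by move=> iW; rewrite ptS//; apply: mem_nth; rewrite -sW.
have idx i : i < size W -> index (pt W x i) S = i.
  by move=> iW; rewrite ptS// index_uniq -?sW.
split.
- by rewrite sW cardfs_gt0; apply/fset0Pn; exists s0.
- by move=> i j E; apply: val_inj; rewrite /= -(idx i)// -(idx j)// E.
move=> M MS.
pose M' y := if insub (index y S) is Some i then M i else fset0.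
have M'pt (i : 'I_(size W)) : M' (pt W x i) = M i.
  by rewrite /M' idx// valK.
have Spt y : y \in S -> exists i : 'I_(size W), y = pt W x i.
  move=> yS; have iW : index y S < size W by rewrite sW index_mem.
  by exists (Ordinal iW); rewrite ptS//= nth_index.
have [|v [vM vp]] := SM M'.
  move=> _ /Spt[i ->]; rewrite M'pt; apply: leq_trans (MS i).
  rewrite cardE -(size_map (fun j : 'I_(size W) => pt W x j)).
  apply: fset_leq_size => y; rewrite in_nbrs_in => /andP[/Spt[j ->] xy].
  by apply/mapP; exists j => //; rewrite mem_enum inE ffunE.
exists (fun i => v (pt W x i)); split=> [i|i j].
  by rewrite -M'pt vM// inS.
by rewrite ffunE => /asboolP; apply: vp; exact: inS.
Qed.

Hypothesis exists_piece : forall x, exists W, good_piece W x.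

Definition word_list (n : nat) : seq (seq nat) :=
  if @choice.unpickle (seq (seq nat)) n is Some W then W else [::].

(* In each component keep the points with the least value of (shape of the piece,
   colour in a colouring of the graph joining points so close that their pieces
   may touch). *)
Lemma exists_scattered_pieces : exists (Q : set X) (q : X -> nat),
  [/\ SX Q /\ forall n, SX [set x | q x = n],
      forall x, Q x -> good_piece (word_list (q x)) x,
      forall x, exists w, Q (act w x) &
      forall x y i j, Q x -> Q y -> i < size (word_list (q x)) ->
        j < size (word_list (q y)) ->
        pt (word_list (q x)) x i = pt (word_list (q y)) y j \/
        G (pt (word_list (q x)) x i) (pt (word_list (q y)) y j) -> x = y].
Proof.
have [q qP] : exists q, forall x, good_piece (word_list (q x)) x /\
    forall n, good_piece (word_list n) x -> q x <= n.
  apply: (least_exists (P := fun n x => good_piece (word_list n) x)) => x.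
  have [W WP] := exists_piece x; exists (choice.pickle W).
  by rewrite /word_list choice.pickleK.
have mq := sa_minimal sX (fun n => measurable_good_piece (word_list n)) qP.
have /choice[k kP] := distance_coloring.
pose R n := \max_(w <- word_list n) size w.
(* Words of shape [n] have length at most [R n], so base points of two touching pieces of this shape
   are within [R n + 1 + R n], where the 1 allows for an edge. The colouring at this radius
   distinguishes them. *)
pose chi x : nat * seq bool := (q x, k ((R (q x) + 1) + R (q x)) x).
have mchi p : SX [set x | chi x = p].
  case: p => n s; rewrite (_ : [set x | _] =
      [set x | q x = n /\ k ((R n + 1) + R n) x = s]).
    by apply: sa_and => //; case: (kP (R n + 1 + R n)).
  by apply/seteqP; split=> x => [[<- <-]|[/= E <-]]; rewrite /chi /= ?E.
pose N x := choice.pickle (chi x).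
have mN n : SX [set x | N x = n].
  rewrite (_ : [set x | _] = [set x | exists p, chi x = p /\ choice.pickle p = n]).
    by apply: sa_ex => // p; apply: sa_and => //; exact: sa_const.
  by apply/seteqP; split=> x /= => [?|[p [<-]]//]; exists (chi x).
pose Q := [set x | forall y, component G x y -> N x <= N y].
have QN x y : Q x -> Q y -> component G x y -> chi x = chi y.
  move=> Qx Qy xy; apply: (pcan_inj choice.pickleK); apply/eqP.
  by rewrite eqn_leq; apply/andP; split; [exact: Qx|apply/Qy/component_sym].
exists Q, q; split.
- split => //; apply: (measurable_all_component) => w.
  rewrite (_ : [set x | _] =
      [set x | exists m n, N x = m /\ (N (act w x) = n /\ m <= n)]).
    apply: sa_ex => // m; apply: sa_ex => // n; apply: sa_and => //.
    apply: sa_and => //; last exact: sa_const.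
    exact: (measurable_comp (measurable_act w) (mN n)).
  apply/seteqP; split=> x /= => [?|[m [n [-> [->]]]]//].
  by exists (N x), (N (act w x)).
- by move=> x _; case: (qP x).
- move=> x; have [|n /asboolP[w wn] min] :=
    @ex_minnP (fun n => `[<exists w, N (act w x) = n>]).
    by exists (N x); apply/asboolP; exists [::].
  exists w => y /componentP[w' <-]; rewrite -act_cat wn.
  by apply: min; apply/asboolP; exists (w ++ w').
- move=> x y i j Qx Qy iW jW xy.
  have inR z t m : t < size (word_list m) -> in_ball (R m) z (pt (word_list m) z t).
    move=> tm; apply: (in_ball_le (r := size (nth [::] (word_list m) t))).
      by apply: (@leq_bigmax_seq _ _ xpredT size) => //; exact: mem_nth.
    by exists (nth [::] (word_list m) t).
  have b1 := inR x i _ iW; have b2 := in_ball_sym (inR y j _ jW).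
  have b := in_ball_trans (in_ball_trans b1 ((in_ball1 _ _).1 xy)) b2.
  have := QN x y Qx Qy (in_ball_component b); rewrite /chi => -[qE].
  rewrite -qE in b * => kE; by case: (kP (R (q x) + 1 + R (q x))) => _; apply.
Qed.

Variables (SY : set (set Y)) (UY : nat -> set Y).
Hypotheses (sUY : separating UY) (mUY : forall n, SY (UY n)).
Variables (L : X -> {fset Y}) (l : nat -> X -> Y).
Hypothesis cardL : forall x, #|` L x| = degree G x.
Hypothesis ml : forall n, borel_fun SX SY (l n).
Hypothesis lP : forall x y, y \in L x <-> exists n, l n x = y.

Let mleq (i j : nat) (f f' : X -> X) : borel_fun SX SX f -> borel_fun SX SX f' ->
  SX [set x | l i (f x) <> l j (f' x)].
Proof.
move=> mf mf'; apply: sa_not => //; apply: (measurable_eq sX sUY mUY).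
  exact: borel_comp mf (ml i).
exact: borel_comp mf' (ml j).
Qed.

Theorem measurable_list_coloring :
  exists c : X -> Y, borel_fun SX SY c /\ list_coloring G L c.
Proof.
have [Q [q [[mQ mq] Qgood Qmeet Qsep]]] := exists_scattered_pieces.
pose W x := word_list (q x).
pose inp y i a := [/\ Q y, i < size (W y) & pt (W y) y i = a].
pose A := [set a | exists y, component G a y /\ exists i, inp y i a].
have minp w i : SX [set a | inp (act w a) i a].
  rewrite (_ : [set a | _] = [set a | exists n, q (act w a) = n /\
    (Q (act w a) /\ (i < size (word_list n) /\ pt (word_list n) (act w a) i = a))]).
    apply: sa_ex => // n; apply: sa_and => //.
      exact: (measurable_comp (measurable_act w) (mq n)).
    apply: sa_and => //; first exact: (measurable_comp (measurable_act w) mQ).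
    apply: sa_and => //; first exact: sa_const.
    have mp := borel_comp (measurable_act w) (measurable_pt (word_list n) i).
    exact: (measurable_eq sX sU mU mp borel_id).
  apply/seteqP; split=> a /=; rewrite /inp /W; last by move=> [n [-> [? [? ?]]]].
  by move=> [? ? ?]; exists (q (act w a)).
have mA : SX A.
  by apply: (measurable_ex_component) => w; apply: sa_ex.
have ptA y i : Q y -> i < size (W y) -> A (pt (W y) y i).
  move=> Qy iW; exists y; split; last by exists i.
  by apply: component_sym => //; apply/componentP; exists (nth [::] (W y) i).
have meetA x : exists w, A (act w x).
  have [w Qw] := Qmeet x; have [W0 _ _] := Qgood _ Qw.
  exists (w ++ nth [::] (W (act w x)) 0); rewrite act_cat.
  exact: ptA.
have [key [mkey key_edge later]] := coloring_order mA meetA.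
have [k [mk kP]] := greedy_coloring mA mkey key_edge later sUY mUY cardL ml lP.
(* The entries of [v] are indices into the lists at the points of the piece based at [y]. They must
   suit the piece itself and the colours already given outside [A]. *)
pose valid (v : seq nat) y := forall i, i < size (W y) ->
  (forall j, j < size (W y) -> G (pt (W y) y i) (pt (W y) y j) ->
     l (nth 0 v i) (pt (W y) y i) <> l (nth 0 v j) (pt (W y) y j)) /\
  (forall z, G (pt (W y) y i) z -> ~ A z ->
     l (nth 0 v i) (pt (W y) y i) <> l (k z) z).
have mout m : SX [set x | forall z, G x z -> ~ A z -> l m x <> l (k z) z].
  apply: (measurable_all_nbr) => i; apply: sa_imp => //.
    by apply: sa_not => //; exact: (measurable_comp (mgs i) mA).
  have mkgs n : SX [set x | k (gs i x) = n] by exact: (measurable_comp (mgs i) (mk n)).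
  apply: (sa_subst (P := fun n x => l m x <> l n (gs i x)) sX mkgs) => n.
  exact: (mleq m n borel_id (mgs i)).
have mvalid v : SX [set y | valid v y].
  apply: (sa_subst (P := fun n y => forall i, i < size (word_list n) ->
    (forall j, j < size (word_list n) ->
       G (pt (word_list n) y i) (pt (word_list n) y j) ->
       l (nth 0 v i) (pt (word_list n) y i) <> l (nth 0 v j) (pt (word_list n) y j)) /\
    (forall z, G (pt (word_list n) y i) z -> ~ A z ->
       l (nth 0 v i) (pt (word_list n) y i) <> l (k z) z)) sX mq) => n.
  apply: sa_all => // i; apply: sa_imp => //; first exact: sa_const.
  have mpt := measurable_pt (word_list n).
  apply: sa_and => //; last exact: (measurable_comp (mpt i) (mout _)).
  apply: sa_all => // j; apply: sa_imp => //; first exact: sa_const.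
  by apply: sa_imp => //; [exact: mG|exact: mleq].
have validQ y : Q y -> exists v, valid v y.
  move=> Qy; have [_ ptI ch] := Qgood _ Qy; rewrite -/(W y) in ptI ch.
  pose out x := fset_set [set z | G x z /\ ~ A z].
  have outE x z : z \in out x <-> G x z /\ ~ A z.
    rewrite in_fset_set; first by rewrite inE.
    by apply: sub_finite_set (finG x) => u [].
  (* At most one colour is lost per neighbour outside [A], so at least as many remain as there are
     neighbours inside the piece. *)
  pose M (i : 'I_(size (W y))) := (L (pt (W y) y i) `\`
    [fset l (k z) z | z in out (pt (W y) y i)])%fset.
  have [|v [vM vp]] := ch M.
    move=> i; set p := pt (W y) y i; pose N := fset_set (neighbors G p).
    have NE z : z \in N <-> G p z by rewrite in_fset_set// inE.
    have oN : (out p `<=` N)%fset.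
      by apply/fsubsetP => z /outE[? _]; apply/NE.
    have in_le : #|[pred j | pt_adjacency (W y) y (i, j)]| <= #|` (N `\` out p)%fset|.
      rewrite cardE -(size_map (fun j : 'I_(size (W y)) => pt (W y) y j)).
      apply: leq_size_fset; first by rewrite map_inj_uniq ?enum_uniq// => a b /ptI.
      move=> _ /mapP[j + ->]; rewrite mem_enum inE ffunE => /asboolP /= pj.
      rewrite inE; apply/andP; split; last exact/NE.
      by apply/negP => /outE[_]; apply; exact: ptA.
    rewrite cardfsDS// in in_le; apply: leq_trans in_le _.
    rewrite /M -/p cardfsD cardL; apply: leq_sub2l.
    apply: (leq_trans (fsubset_leq_card (fsubsetIr _ _))).
    exact: leq_imfset_card.
  have /choice[m mP] : forall i, exists m, forall h : i < size (W y),
      l m (pt (W y) y i) = v (Ordinal h).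
    move=> i; have [iW|niW] := pselect (is_true (i < size (W y))); last by exists 0.
    have := vM (Ordinal iW); rewrite inE => /andP[_ /lP[m mi]].
    by exists m => h; rewrite (bool_irrelevance h iW).
  exists (mkseq m (size (W y))) => i iW; rewrite nth_mkseq// (mP i iW); split.
    move=> j jW ij; rewrite nth_mkseq// (mP j jW); apply: vp.
    by rewrite ffunE; apply/asboolP.
  move=> z iz nAz E; have := vM (Ordinal iW); rewrite inE => /andP[/negP + _]; apply.
  by apply/imfsetP; exists z => //=; apply/outE.
pose dec n : seq nat := if choice.unpickle n is Some v then v else [::].
(* The disjunct [~ Q y] makes the search for the least code total. *)
have [t tP] : exists t, forall y, (valid (dec (t y)) y \/ ~ Q y) /\
    forall n, valid (dec n) y \/ ~ Q y -> t y <= n.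
  apply: (least_exists (P := fun n y => valid (dec n) y \/ ~ Q y)) => y.
  have [/validQ[v vy]|nQ] := pselect (Q y); last by exists 0; right.
  by exists (choice.pickle v); rewrite /dec choice.pickleK; left.
have mt : forall n, SX [set y | t y = n].
  apply: (sa_minimal sX (P := fun n y => valid (dec n) y \/ ~ Q y)) tP => n.
  by apply: sa_or => //; exact: sa_not.
(* Pieces are disjoint and list distinct points, so a point of [A] determines its base point and its
   position. *)
have /choice[kk kkP] : forall a, exists m,
    (forall y i, inp y i a -> m = nth 0 (dec (t y)) i) /\ (~ A a -> m = k a).
  move=> a; have [[y [_ [i yia]]]|nAa] := pselect (A a); last first.
    exists (k a); split => // y i [Qy iW E]; case: nAa; rewrite -E; exact: ptA.
  exists (nth 0 (dec (t y)) i); split; last first.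
    by case: yia => Qy iW <- []; exact: ptA.
  move=> y' i' [Qy' iW' E']; case: yia => Qy iW E.
  have yE : y = y' by apply: (Qsep y y' i i') => //; left; rewrite -/(W y) -/(W y') E E'.
  rewrite -{}yE in Qy' iW' E' *.
  have [_ ptI _] := Qgood _ Qy.
  have : Ordinal iW = Ordinal iW' by apply: ptI; exact: etrans E (esym E').
  by case=> ->.
have mkk m : SX [set a | kk a = m].
  rewrite (_ : [set a | _] = [set a | (exists w i, inp (act w a) i a /\
      exists n, t (act w a) = n /\ nth 0 (dec n) i = m) \/ (~ A a /\ k a = m)]).
    apply: sa_or => //.
      apply: sa_ex => // w; apply: sa_ex => // i; apply: sa_and => //.
      apply: sa_ex => // n; apply: sa_and => //; last exact: sa_const.
      exact: (measurable_comp (measurable_act w) (mt n)).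
    by apply: sa_and => //; exact: sa_not.
  apply/seteqP; split=> a /=.
    move=> <-; have [[y [/componentP[w wy] [i yia]]]|nAa] := pselect (A a).
      left; exists w, i; rewrite wy; split => //; exists (t y); split => //.
      by rewrite ((kkP a).1 y i yia).
    by right; split => //; rewrite (kkP a).2.
  move=> [[w [i [h [n [<- <-]]]]]|[nAa <-]]; first exact: (kkP a).1.
  exact: (kkP a).2.
exists (fun x => l (kk x) x); split; [|split].
- move=> B mB; rewrite (_ : _ @^-1` _ = [set x | exists m, kk x = m /\ B (l m x)]).
    by apply: sa_ex => // m; apply: sa_and => //; exact: (ml m mB).
  by apply/seteqP; split=> x /= => [?|[m [<-]]//]; exists (kk x).
- by move=> x; apply/lP; exists (kk x).
have tvalid y : Q y -> valid (dec (t y)) y by move=> Qy; case: (tP y) => -[].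
have main x y : A x -> G x y -> l (kk x) x <> l (kk y) y.
  move=> [u [_ [i uix]]] xy; rewrite ((kkP x).1 u i uix).
  case: uix => Qu iW xE; have [vin vout] := tvalid u Qu i iW; rewrite xE in vin vout.
  (* A neighbour in [A] belongs to the same piece, since distinct pieces are nonadjacent. *)
  have [[u' [_ [j ujy]]]|nAy] := pselect (A y); last first.
    by rewrite ((kkP y).2 nAy); exact: vout.
  rewrite ((kkP y).1 u' j ujy); case: ujy => Qu' jW yE.
  have uE : u = u' by apply: (Qsep u u' i j) => //; right; rewrite -/(W u) -/(W u') xE yE.
  rewrite -{}uE in jW yE *; have := vin j jW; rewrite yE; exact.
move=> x y xy; have [Ax|nAx] := pselect (A x); first exact: main.
have [Ay|nAy] := pselect (A y).
  by apply/nesym/main => //; exact: graphG.1.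
by rewrite (kkP x).2// (kkP y).2//; exact: kP.
Qed.

End pieces.
End borel_graph.

(** * Components that are not Gallai trees *)

Lemma component_connected (X : choiceType) (G : X -> X -> Prop) x :
  is_graph G -> connected_on G (component G x).
Proof.
move=> graphG y z Cy Cz.
have : clos_refl_trans X G y z by apply: rt_trans Cz; exact: component_sym.
move=> yz; elim: yz Cy {Cz} => [a b ab Ca|a _|a b c ab IHab bc IHbc Ca].
- by apply: rt_step; split=> //; apply: rt_trans Ca _; exact: rt_step.
- exact: rt_refl.
- by apply: rt_trans (IHab Ca) (IHbc _); exact: rt_trans Ca ab.
Qed.

Lemma not_gallai_block (X : choiceType) (G : X -> X -> Prop) x :
  is_graph G -> ~ gallai_tree_on G (component G x) ->
  exists B, [/\ B `<=` component G x, biconnected G B, ~ complete_on G B &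
    ~ odd_cycle_on G B].
Proof.
move=> graphG ng; apply: contrapT => no; apply: ng.
split; first exact: component_connected.
move=> B [BC biB _]; apply: contrapT => /not_orP[nc no'].
by apply: no; exists B.
Qed.

(** A component reduced to one vertex has only complete subsets. Excluding it makes all lists
    nonempty, as total enumerations require. *)
Lemma not_gallai_nbr (X : choiceType) (G : X -> X -> Prop) x :
  is_graph G -> ~ gallai_tree_on G (component G x) -> exists y, G x y.
Proof.
move=> graphG /(not_gallai_block graphG)[B [BC _ nc _]].
apply: contrapT => nox; apply: nc => a b Ba Bb ab.
have only y : component G x y -> y = x.
  by move=> /clos_rt_rt1n_iff; case=> // z w xz _; case: nox; exists z.
by case: ab; rewrite (only a (BC a Ba)) (only b (BC b Bb)).
Qed.

Theorem theorem1p4 (R : realType) (X : choiceType) (SX : set (set X))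
    (G : X -> X -> Prop)
    (X_standard : standard_borel R SX)
    (G_borel : borel_graph SX G)
    (G_locally_finite : locally_finite G)
    (no_gallai : forall x : X, ~ gallai_tree_on G (component G x)) :
  borel_degree_list_colorable R SX G.
Proof.
move=> Y pY L mL cardL; have [graphG mG] := G_borel.
have sX := standard_borel_sigma_algebra X_standard.
(* A default colour is taken from the list of a point; the empty space is coloured by the empty
   function. *)
have [[x0 _]|noX] := pselect (exists x : X, True); last first.
  have F (x : X) : False by apply: noX; exists x.
  exists (fun x => False_rect Y (F x)); split; last by split => x; case: (F x).
  move=> B _; rewrite (_ : _ @^-1` _ = set0); first by case: sX.
  by apply/seteqP; split=> x; case: (F x).
have L0 x : exists y, y \in L x.
  have [y xy] := not_gallai_nbr graphG (no_gallai x).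
  apply/fset0Pn; rewrite -cardfs_gt0 cardL cardfs_gt0; apply/fset0Pn; exists y.
  by rewrite in_fset_set// inE.
have [y0 _] := L0 x0.
have [UX sUX mUX] := standard_borel_separating x0 X_standard.
have [UY sUY mUY] := polish_separating y0 pY.
have sY := borel_sigma_algebra Y.
have mhit B : borel Y B -> SX [set x | exists y, y \in L x /\ B y].
  exact: measurable_list_hit.
have mdeg n : SX [set x | degree G x = n].
  have := measurable_card sUY sX sY mUY mhit n.
  by congr SX; apply/seteqP; split=> x /=; rewrite cardL.
have mN B := measurable_neighborhood X_standard mG G_locally_finite mdeg (B := B).
have [l [ml lP]] := measurable_enumeration sUY sX sY mUY mhit L0.
pose V x := (x |` fset_set (neighbors G x))%fset.
have VE x y : y \in V x <-> x = y \/ G x y.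
  rewrite in_fset1U in_fset_set//; split.
    by move=> /predU1P[->|]; [left|rewrite inE; right].
  by move=> [->|xy]; rewrite ?eqxx// mem_set// orbT.
have [||gs [mgs gsP]] := measurable_enumeration sUX sX sX mUX (V := V).
- move=> B mB; rewrite (_ : [set x | _] = [set x | B x \/ exists y, G x y /\ B y]).
    by apply: sa_or => //; exact: mN.
  apply/seteqP; split=> x /=.
    by move=> [y [/VE[->|xy] By]]; [left|right; exists y].
  by move=> [Bx|[y [xy By]]]; [exists x|exists y]; split=> //; apply/VE; [left|right].
- by move=> x; exists x; apply/VE; left.
apply: (measurable_list_coloring sX graphG G_locally_finite _ sUX mUX mgs _ _ sUY mUY
  cardL ml lP).
- by move=> f f'; exact: (measurable_prod_algebra sX mG).
- by move=> x y; rewrite -VE.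
move=> x; have [B [BC biB nc no]] := not_gallai_block graphG (no_gallai x).
have [S SB chS] := exists_choosable y0 graphG biB nc no.
apply: (choosable_good_piece _ y0 (subset_trans SB BC) chS) => u w.
by rewrite -VE.
Qed.
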